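(* Suppose that $g$ is twice differentiable and that, for some $\xi_0\in\mathcal{P}$, $Z^{*}(\xi_0)\neq\emptyset$. Then, for $k\ge0$ and $\bar z^k\in Z^{*}(\xi_k)$, if $\mathrm{P}(\xi_k)$ is strongly regular at $\bar z^k$, there exist neighborhoods $\mathcal{B}(\bar z^k,r_z)$ of $\bar z^k$ and $\mathcal{B}(\xi_k,r_\xi)$ of $\xi_k$ such that: (a) The set of KKT points $Z^{*}(\xi_{k+1})$ of $\mathrm{P}(\xi_{k+1})$ is nonempty for any $\xi_{k+1}\in\mathcal{B}(\xi_k,r_\xi)$. (b) If, in addition, there exists a constant $0\le\tilde\kappa<\frac1{2\gamma}$ such that $\|\nabla_x^2\mathcal{L}(\bar z^k)-H_k\|\le\tilde\kappa$ for all $k\ge0$, then, for $z^k\in\mathcal{B}(\bar z^k,r_z)$ and $\xi_{k+1}\in\mathcal{B}(\xi_k,r_\xi)$, the subproblem $\mathrm{P}(x^k,H_k;\xi_{k+1})$ is uniquely solvable in the neighborhood $\mathcal{B}(\bar z^k,r_z)$ (i.e. it has exactly one KKT point there). (c) If, moreover, there exists a constant $0\le\omega<+\infty$ such that $\|F'(z)-F'(\bar z^k)\|\le\omega\|z-\bar z^k\|$ for all $z\in\mathcal{B}(\bar z^k,r_z)$, then the sequence $\{z^k\}_{k\ge0}$ generated by Algorithm PCSCP, where $z^k\in\mathcal{B}(\bar z^k,r_z)$ and $\xi_{k+1}\in\mathcal{B}(\xi_k,r_\xi)$, satisfies $$\|z^{k+1}-\bar z^{k+1}\|\le\left(\tilde\alpha+\tilde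 c_1\|z^k-\bar z^k\|\right)\|z^k-\bar z^k\|+\left(\tilde c_2+\tilde c_3\|\xi_{k+1}-\xi_k\|\right)\|\xi_{k+1}-\xi_k\|,$$ where $0\le\tilde\alpha<1$, $0\le\tilde c_i<+\infty$ $(i=1,2,3)$ and $\tilde c_2>0$ are constants and $\bar z^{k+1}\in Z^{*}(\xi_{k+1})$. (d) (Under the hypotheses of (a)-(c) for all $k\ge 0$.) If the initial point $z^0$ in Algorithm PCSCP is chosen such that $\|z^0-\bar z^0\|\le\tilde r_z$, where $\bar z^0\in Z^{*}(\xi_0)$ and $0<\tilde r_z<\bar{\tilde r}_z:=\tilde c_1^{-1}(1-\tilde\alpha)$, then, for all $k\ge0$, $$\|z^{k+1}-\bar z^{k+1}\|\le\tilde r_z,$$ provided that $\|\xi_{k+1}-\xi_k\|\le\tilde r_\xi$ with $0<\tilde r_\xi\le\bar{\tilde r}_\xi$, where $$\bar{\tilde r}_\xi:=\begin{cases}(2\tilde c_3)^{-1}\left[\sqrt{\tilde c_2^2+4\tilde c_3\tilde r_z(1-\tilde\alpha-\tilde c_1\tilde r_z)}-\tilde c_2\right]&\text{if }\tilde c_3>0,\\ \tilde c_2^{-1}\tilde r_z(1-\tilde\alpha-\tilde c_1\tilde r_z)&\text{if }\tilde c_3=0.\end{cases}$$ Consequently, the error sequence $\{\|z^k-\bar z^k\|\}_{k\ge0}$ between the exact KKT point $\bar z^k$ and the approximate KKT point $z^k$ of $\mathrm{P}(\xi_k)$ is bounded.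
   Context: Notation: $\|\cdot\|$ is the Euclidean norm (and the induced norm for matrices); $\mathcal{B}(x,r)$ is the open ball of radius $r$ centered at $x$; $\mathcal{S}^n_+$ is the set of real symmetric positive semidefinite $n\times n$ matrices; $g'$ is the Jacobian of $g$. If $\tilde c_1=0$, $\bar{\tilde r}_z$ is read as $+\infty$. Parametric problem. Let $c\in\mathbb{R}^n$, $g:\mathbb{R}^n\to\mathbb{R}^m$, $M\in\mathbb{R}^{m\times p}$, let $\Omega\subseteq\mathbb{R}^n$ be nonempty, closed and convex, and let $\mathcal{P}\subseteq\mathbb{R}^p$ be the parameter set. $\mathrm{P}(\xi)$ is: $\min_{x\in\mathbb{R}^n} c^Tx$ subject to $g(x)+M\xi=0$, $x\in\Omega$. Let $\mathcal{N}_\Omega(x)=\{u: u^T(x-v)\ge0\ \forall v\in\Omega\}$ if $x\in\Omega$ and $\emptyset$ otherwise be the normal cone. Put $K:=\Omega\times\mathbb{R}^m$, with normal cone $\mathcal{N}_K$, $z=(x,y)\in\mathbb{R}^{n}\times\mathbb{R}^m$, $$F(z):=\begin{pmatrix}c+g'(x)^Ty\\ g(x)\end{pmatrix},\qquad C:=\begin{bmatrix}0\\ M\end{bmatrix}.$$ A KKT point of $\mathrm{P}(\xi)$ is a $z$ with $0\in F(z)+C\xi+\mathcal{N}_K(z)$; $Z^{*}(\xi)$ is the set of KKT points. Put $\nabla_x^2\mathcal{L}(z):=\sum_{i=1}^m y_i\nabla^2g_i(x)$. Strong regularity. For $\bar z^k\in Z^{*}(\xi_k)$ put $L(z;\bar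 z^k,\xi_k):=F(\bar z^k)+F'(\bar z^k)(z-\bar z^k)+C\xi_k+\mathcal{N}_K(z)$ and $L^{-1}(\delta;\bar z^k,\xi_k):=\{z:\delta\in L(z;\bar z^k,\xi_k)\}$. $\mathrm{P}(\xi_k)$ is strongly regular at $\bar z^k$ if there are balls $\mathcal{B}(0,\bar r_\delta)$ and $\mathcal{B}(\bar z^k,\bar r_z)$ such that $z^*_k(\delta):=\mathcal{B}(\bar z^k,\bar r_z)\cap L^{-1}(\delta;\bar z^k,\xi_k)$ is single-valued and Lipschitz continuous on $\mathcal{B}(0,\bar r_\delta)$ with Lipschitz constant $0<\gamma<+\infty$. The constants $\gamma,\bar r_z,\bar r_\delta$ do not depend on $k$. Subproblem. For $x^k\in\Omega$ and $H_k\in\mathcal{S}^n_+$, $\mathrm{P}(x^k,H_k;\xi)$ is the convex problem: $\min_x\{c^Tx+\frac12(x-x^k)^TH_k(x-x^k)\}$ subject to $g(x^k)+g'(x^k)(x-x^k)+M\xi=0$, $x\in\Omega$. Its KKT points are the $z=(x,y)$ with $0\in c+H_k(x-x^k)+g'(x^k)^Ty+\mathcal{N}_\Omega(x)$ and $g(x^k)+g'(x^k)(x-x^k)+M\xi=0$. The Slater condition $\mathrm{ri}(\Omega)\cap\{x: g(x^k)+g'(x^k)(x-x^k)+M\xi_{k+1}=0\}\ne\emptyset$ is assumed for the subproblems, so KKT points are exactly the pairs (solution, multiplier). Algorithm PCSCP. Start from $z^0=(x^0,y^0)$, an approximate KKT point of $\mathrm{P}(\xi_0)$, and $H_0\in\mathcal{S}^n_+$.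 At iteration $k=0,1,\dots$: get a new parameter $\xi_{k+1}\in\mathcal{P}$; let $z^{k+1}=(x^{k+1},y^{k+1})$ be the solution and the corresponding multiplier of $\mathrm{P}(x^k,H_k;\xi_{k+1})$; choose $H_{k+1}\in\mathcal{S}^n_+$. Convention: $\bar z^{k+1}$ denotes the unique point of $Z^{*}(\xi_{k+1})\cap\mathcal{B}(\bar z^k,r_z)$, for $\xi_{k+1}\in\mathcal{B}(\xi_k,r_\xi)$. In (d) the constants $\tilde\alpha,\tilde c_i$ and the radii $r_z,r_\xi$ are the same for all $k$, and the points stay in the neighborhoods of (a)-(c), i.e. $\tilde r_z\le r_z$ and $\xi_{k+1}\in\mathcal{B}(\xi_k,r_\xi)$. *)

(* Defs.v *)
From HB Require Import structures.
From mathcomp Require Import all_boot all_order all_algebra.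
From mathcomp Require Import all_classical all_reals all_analysis.

Set Implicit Arguments.
Unset Strict Implicit.
Unset Printing Implicit Defensive.

Import Order.TTheory GRing.Theory Num.Theory.
Import numFieldNormedType.Exports.

Local Open Scope classical_set_scope.
Local Open Scope ring_scope.

Section Euclidean.
Variable R : realType.

Definition dotv d (u v : 'cV[R]_d) : R := (u^T *m v) 0 0.

(* The norm `|_| of the library on matrices is the maximum norm. *)
Definition enorm d (v : 'cV[R]_d) : R := Num.sqrt (\sum_i v i 0 ^+ 2).

Definition eball d (x : 'cV[R]_d) (r : R) : set 'cV[R]_d :=
  [set y | enorm (y - x) < r].

Definition opnorm d e (A : 'M[R]_(d, e)) : R :=
  sup [set enorm (A *m v) | v in [set v : 'cV[R]_e | enorm v <= 1]].

Definition psd d (H : 'M[R]_d) : Prop :=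
  H^T = H /\ forall v : 'cV[R]_d, 0 <= dotv v (H *m v).

Definition normal_cone d (S : set 'cV[R]_d) (x : 'cV[R]_d) : set 'cV[R]_d :=
  [set u | S x /\ forall v, S v -> 0 <= dotv u (x - v)].

Definition affine_hull d (S : set 'cV[R]_d) : set 'cV[R]_d :=
  [set x | exists k (v : 'I_k -> 'cV[R]_d) (a : 'I_k -> R),
     [/\ forall i, S (v i), \sum_i a i = 1 & x = \sum_i a i *: v i]].

Definition rel_interior d (S : set 'cV[R]_d) : set 'cV[R]_d :=
  [set x | S x /\ exists2 e : R, 0 < e & eball x e `&` affine_hull S `<=` S].

(* Jacobian for column vectors; the library's [jacobian] acts on row vectors
   by multiplication on the right, i.e. is the transpose of this matrix. *)
Definition jac d e (f : 'cV[R]_d -> 'cV[R]_e) (x : 'cV[R]_d) : 'M[R]_(e, d) :=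
  \matrix_(i, j) ('d f x (delta_mx j 0)) i 0.

Definition twice_differentiable d e (f : 'cV[R]_d -> 'cV[R]_e) : Prop :=
  (forall x, differentiable f x) /\ (forall x, differentiable (jac f) x).

Definition grad d e (f : 'cV[R]_d -> 'cV[R]_e) (i : 'I_e) (x : 'cV[R]_d) :
  'cV[R]_d := (row i (jac f x))^T.

Definition hess d e (f : 'cV[R]_d -> 'cV[R]_e) (i : 'I_e) (x : 'cV[R]_d) :
  'M[R]_d := jac (grad f i) x.

End Euclidean.

Section ParametricProblem.
Variables (R : realType) (n m p : nat).
Variables (c : 'cV[R]_n) (g : 'cV[R]_n -> 'cV[R]_m) (M : 'M[R]_(m, p)).
Variable Omega : set 'cV[R]_n.

(* A pair z = (x, y) is the block column [col_mx x y]. *)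
Let xpart (z : 'cV[R]_(n + m)) : 'cV[R]_n := usubmx z.
Let ypart (z : 'cV[R]_(n + m)) : 'cV[R]_m := dsubmx z.

Definition Kset : set 'cV[R]_(n + m) := [set z | Omega (xpart z)].

Definition Fmap (z : 'cV[R]_(n + m)) : 'cV[R]_(n + m) :=
  col_mx (c + (jac g (xpart z))^T *m ypart z) (g (xpart z)).

Definition Cmat : 'M[R]_(n + m, p) := col_mx 0 M.

Definition Zstar (xi : 'cV[R]_p) : set 'cV[R]_(n + m) :=
  [set z | [set Fmap z + Cmat *m xi + u | u in normal_cone Kset z] 0].

Definition hessL (z : 'cV[R]_(n + m)) : 'M[R]_n :=
  \sum_(i < m) ypart z i 0 *: hess g i (xpart z).

Definition Llin (z zbar : 'cV[R]_(n + m)) (xi : 'cV[R]_p) :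
    set 'cV[R]_(n + m) :=
  [set Fmap zbar + jac Fmap zbar *m (z - zbar) + Cmat *m xi + u
     | u in normal_cone Kset z].

Definition Linv (delta zbar : 'cV[R]_(n + m)) (xi : 'cV[R]_p) :
    set 'cV[R]_(n + m) :=
  [set z | Llin z zbar xi delta].

(* [gamma] is the Lipschitz constant; [rz], [rdelta] are the two radii. *)
Definition strongly_regular (gamma rz rdelta : R) (xi : 'cV[R]_p)
    (zbar : 'cV[R]_(n + m)) : Prop :=
  exists zs : 'cV[R]_(n + m) -> 'cV[R]_(n + m),
    (forall delta, eball 0 rdelta delta ->
       eball zbar rz `&` Linv delta zbar xi = [set zs delta]) /\
    (forall delta1 delta2, eball 0 rdelta delta1 -> eball 0 rdelta delta2 ->
       enorm (zs delta1 - zs delta2) <= gamma * enorm (delta1 - delta2)).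

Section Subproblem.
Variables (xk : 'cV[R]_n) (H : 'M[R]_n) (xi : 'cV[R]_p).

Definition sub_objective (x : 'cV[R]_n) : R :=
  dotv c x + 2^-1 * dotv (x - xk) (H *m (x - xk)).

Definition sub_linearized : set 'cV[R]_n :=
  [set x | g xk + jac g xk *m (x - xk) + M *m xi = 0].

Definition sub_solution : set 'cV[R]_n :=
  [set x | (sub_linearized `&` Omega) x /\
     forall x', (sub_linearized `&` Omega) x' ->
       sub_objective x <= sub_objective x'].

Definition sub_kkt : set 'cV[R]_(n + m) :=
  [set z | [set c + H *m (xpart z - xk) + (jac g xk)^T *m ypart z + u
              | u in normal_cone Omega (xpart z)] 0 /\
           sub_linearized (xpart z)].

Definition slater : Prop := rel_interior Omega `&` sub_linearized !=set0.

(* The pairs (solution, corresponding multiplier). *)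
Definition sub_solution_multiplier : set 'cV[R]_(n + m) :=
  [set z | sub_solution (xpart z) /\ sub_kkt z].

End Subproblem.

(* [H k], [z k] and [xi k.+1] satisfy the rules of Algorithm PCSCP. *)
Definition pcscp_run (P : set 'cV[R]_p) (xi : nat -> 'cV[R]_p)
    (H : nat -> 'M[R]_n) (z : nat -> 'cV[R]_(n + m)) : Prop :=
  [/\ forall k, P (xi k),
      Omega (xpart (z 0%N)),
      forall k, psd (H k),
      forall k, slater (xpart (z k)) (xi k.+1) &
      forall k,
        sub_solution_multiplier (xpart (z k)) (H k) (xi k.+1) (z k.+1)].

Definition jacF_lipschitz (omega rz : R) (zbar : 'cV[R]_(n + m)) : Prop :=
  forall z, eball zbar rz z ->
    opnorm (jac Fmap z - jac Fmap zbar) <= omega * enorm (z - zbar).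

Section LocalClaims.
Variables (rz rxi : R) (xik : 'cV[R]_p) (zbark : 'cV[R]_(n + m)).

Definition kkt_nonempty : Prop :=
  forall xi', eball xik rxi xi' -> Zstar xi' !=set0.

Definition sub_uniquely_solvable (kappa : R) : Prop :=
  forall (H : 'M[R]_n) (zk : 'cV[R]_(n + m)) (xi' : 'cV[R]_p),
    psd H -> opnorm (hessL zbark - H) <= kappa ->
    Omega (xpart zk) -> eball zbark rz zk -> eball xik rxi xi' ->
    slater (xpart zk) xi' ->
    exists z', eball zbark rz `&` sub_kkt (xpart zk) H xi' = [set z'].

(* [zbar'] is the exact KKT point at the new parameter: the unique element of
   [Zstar xi'] in the ball around [zbark]. *)
Definition error_estimate (kappa omega alpha c1 c2 c3 : R) : Prop :=
  jacF_lipschitz omega rz zbark ->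
  forall xi', eball xik rxi xi' ->
  exists2 zbar', Zstar xi' `&` eball zbark rz = [set zbar'] &
    forall (H : 'M[R]_n) (zk z' : 'cV[R]_(n + m)),
      psd H -> opnorm (hessL zbark - H) <= kappa ->
      Omega (xpart zk) -> eball zbark rz zk ->
      slater (xpart zk) xi' ->
      sub_solution_multiplier (xpart zk) H xi' z' ->
      enorm (z' - zbar') <=
        (alpha + c1 * enorm (zk - zbark)) * enorm (zk - zbark)
        + (c2 + c3 * enorm (xi' - xik)) * enorm (xi' - xik).

End LocalClaims.

End ParametricProblem.

Section Radii.
Variable R : realType.

Definition rz_bar (alpha c1 : R) : \bar R :=
  if c1 == 0 then +oo%E else (c1^-1 * (1 - alpha))%:E.

Definition rxi_bar (alpha c1 c2 c3 rtz : R) : R :=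
  if c3 == 0 then c2^-1 * rtz * (1 - alpha - c1 * rtz)
  else (2 * c3)^-1 *
       (Num.sqrt (c2 ^+ 2 + 4 * c3 * rtz * (1 - alpha - c1 * rtz)) - c2).

End Radii.

(* Main.v *)
(** Subtracting a map G from the linearization of the KKT system at [zbar] gives
    a gap e(z), and z solves 0 \in G(z) + N_K(z) exactly when z is a strong
    regularity solution for the perturbation e(z), i.e. a fixed point of zs o e.
    For the subproblem, e is affine with Lipschitz constant kappa + O(r), and
    gamma * kappa < 1/2 makes zs o e a contraction of the ball of radius r; for
    the problem at the new parameter the same holds as soon as F' is Lipschitz
    at [zbar].  Without that bound F is merely differentiable at [zbar], zs o e
    need not be contracting, and nonemptiness of the KKT set rests on Brouwer's
    theorem, which is obtained from Kuhn's labelling lemma on a grid.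
    The solution returned by the algorithm is not assumed to be close to [zbar]:
    the KKT set of the convex subproblem is convex, hence a locally unique KKT
    point is globally unique.  Comparing the two fixed-point equations at the
    exact KKT point bounds the error by gamma / (1 - q) times the residual of the
    subproblem at that point, which yields (c); (d) follows by induction. *)
Require Import Defs.
From HB Require Import structures.
From mathcomp Require Import all_boot all_order all_algebra all_fingroup.
From mathcomp Require Import all_classical all_reals all_analysis.
From mathcomp Require Import ring lra.

Set Implicit Arguments.
Unset Strict Implicit.
Unset Printing Implicit Defensive.

Import Order.TTheory GRing.Theory Num.Theory.
Import numFieldNormedType.Exports.

(** * Kuhn's labelling lemma *)

(** The bound 1/2, rather than 1, on [gamma * kappa] has two sources. The point [xk] may lie almost
    at distance r from the centre, so the gap at [zbar] can cost nearly q * r out of the room (1 -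
    q) * r that a q-contraction leaves for moving the centre; the rest, (1 - 2 * q) * r, pays for
    the change of parameter. Moreover the linear rate in (c) is gamma * kappa / (1 - q), which is
    below 1 because gamma * kappa < 1/2 < 1 - q. The order of quantifiers shapes the choice of
    radii. The constants of the estimate come before the iterate, so they are built from the uniform
    data only. In (a) and (b) no bound on F' may be used and the radii shrink with the iterate; in
    (d) that bound is at hand and gives radii common to all iterates. Kuhn's lemma is proved by a
    parity count written as a mod 2 cup product: exchanging one label changes the count by the sum
    of a coboundary over the grid, which vanishes by a mod 2 Stokes argument. *)

Section Cup.
Variable V : Type.
Implicit Types (f : nat -> V -> bool) (h : V -> bool) (w : nat -> V).

(* The mod 2 cup product of the coboundaries of f 0, ..., f (m - 1), evaluated on
   the ordered simplex w 0, ..., w m. *)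
Fixpoint cup_prod m f w : bool :=
  if m is m'.+1 then (f 0 (w 1) (+) f 0 (w 0)) && cup_prod m' (f \o succn) (w \o succn)
  else true.

(* The same product where the j-th factor is the 0-cochain h itself, not its
   coboundary; it has degree m, and the j-th function of f is skipped. *)
Fixpoint cup_with j h m f w : bool :=
  match j, m with
  | 0, _ => h (w 0) && cup_prod m (f \o succn) w
  | j'.+1, m'.+1 =>
      (f 0 (w 1) (+) f 0 (w 0)) && cup_with j' h m' (f \o succn) (w \o succn)
  | _, _ => false
  end.

Lemma cup_prodP m f w :
  reflect (forall i, i < m -> f i (w i.+1) != f i (w i)) (cup_prod m f w).
Proof.
elim: m f w => [|m IH] f w /=; first by apply: (iffP idP).
apply: (iffP andP) => [[H1 /IH H2] [|i] ltim|H].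
- by rewrite -negb_eqb in H1.
- exact: H2.
- split; first by have := H 0 isT; rewrite -negb_eqb.
  by apply/IH => i ltim; apply: H.
Qed.

Lemma eq_cup_prod m f f' w w' : (forall i, i < m -> f i =1 f' i) ->
  (forall i, i <= m -> w i = w' i) -> cup_prod m f w = cup_prod m f' w'.
Proof.
elim: m f f' w w' => [|m IH] f f' w w' Hf Hw //=.
rewrite !Hf // !Hw //; congr andb; apply: IH => i Hi /=; [exact: Hf|exact: Hw].
Qed.

Lemma eq_cup_with j m h f w w' : j <= m ->
  (forall i, i <= m -> w i = w' i) -> cup_with j h m f w = cup_with j h m f w'.
Proof.
elim: j m f w w' => [|j IH] [|m] f w w' Hj Hw //=.
- by rewrite Hw.
- rewrite !Hw //; congr (_ && (_ && _)).
  by apply: eq_cup_prod => i Hi //=; apply: Hw.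
- by rewrite !Hw //; congr andb; apply: IH => // i Hi; apply: Hw.
Qed.

Lemma cup_with_arg j m h f w : cup_with j h m f w -> h (w j).
Proof.
elim: j m f w => [|j IH] [|m] f w //= /andP[] //.
by move=> _ /IH.
Qed.

(** This is what makes the cochain vanish on every simplex along which one of the [f i], i different
    from j, is constant. *)
Lemma cup_with_jump j m h f w i : j <= m -> cup_with j h m f w ->
  i <= m -> i != j ->
  exists a b, [/\ a <= m, b <= m & f i (w a) != f i (w b)].
Proof.
elim: j m f w i => [|j IH] m f w i Hj.
  case: i => [_ _ //|i /= /andP[_ /cup_prodP H] Hi _].
  by exists i.+1, i; split => //; [exact: ltnW|exact: H].
case: m Hj => // m Hj; case: i => [|i] /= /andP[H1 H2] Hi Hij.
  by exists 1, 0; split => //; rewrite -negb_eqb in H1.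
have [a [b [Ha Hb Hab]]] := IH m (f \o succn) _ i Hj H2 Hi Hij.
by exists a.+1, b.+1.
Qed.

Lemma bumpSS k i : bump k.+1 i.+1 = (bump k i).+1.
Proof. by rewrite /bump ltnS addnS. Qed.

Local Notation "\xor_ ( k < n ) F" := (\big[addb/false]_(k < n) F)
  (at level 41, F at level 41, k, n at level 50).

Lemma xor_andl n (b : bool) (F : 'I_n -> bool) :
  \xor_(k < n) (b && F k) = b && \xor_(k < n) F k.
Proof. by case: b => //=; rewrite big1. Qed.

(* [w \o bump k] is the facet of w opposite to its k-th vertex. *)
Lemma cup_prod_closed m f w : \xor_(k < m.+2) cup_prod m f (w \o bump k) = false.
Proof.
elim: m f w => [|m IH] f w; first by rewrite !big_ord_recl big_ord0.
rewrite big_ord_recl.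
have := IH (f \o succn) (w \o succn); rewrite big_ord_recl.
set a := cup_prod m _ _ => Ha.
rewrite big_ord_recl.
have Hk (k : 'I_m.+1) :
    cup_prod m.+1 f (w \o bump (lift ord0 (lift ord0 k))) =
    (f 0 (w 1) (+) f 0 (w 0)) && cup_prod m (f \o succn) (w \o succn \o bump (lift ord0 k)).
  by congr andb; apply: eq_cup_prod => // i _; rewrite /= -bumpSS.
under eq_bigr => k _ do rewrite Hk.
rewrite xor_andl; move: Ha; set s := bigop _ _ _ => Ha /=.
have -> : cup_prod m (f \o succn) ((w \o bump 0) \o succn) = a by [].
(* All terms now share the factor [a], and their first factors run over the three edges of the
   triangle [w 0], [w 1], [w 2], whose sum is zero mod 2. *)
have -> : s = a by case: a s Ha => [] [].
by rewrite /bump /=; case: (f 0 _); case: (f 0 _); case: (f 0 _); case: a {Ha Hk}.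
Qed.

Definition upd f j h i := if i == j then h else f i.

(** Leibniz rule mod 2: all factors except [h] are coboundaries, hence closed, so only the
    coboundary of [h] survives in slot j. *)
Lemma cup_with_leibniz j m h f w : j <= m ->
  \xor_(k < m.+2) cup_with j h m f (w \o bump k) = cup_prod m.+1 (upd f j h) w.
Proof.
elim: j m f w => [|j IH] m f w Hj.
  rewrite big_ord_recl /=.
  under eq_bigr => k _ do rewrite (_ : _ && _ = h (w 0) && cup_prod m (f \o succn) (w \o bump (lift ord0 k))) //.
  rewrite xor_andl.
  have := cup_prod_closed m (f \o succn) w; rewrite big_ord_recl.
  have -> : cup_prod m (upd f 0 h \o succn) (w \o succn) = cup_prod m (f \o succn) (w \o succn) by apply: eq_cup_prod.
  rewrite /upd /=; set s := bigop _ _ _.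
  rewrite -/(bump 0 0) (_ : bump 0 0 = 1) //.
  by case: cup_prod; case: s => //=; case: (h _); case: (h _).
case: m Hj => // m Hj.
rewrite big_ord_recl big_ord_recl.
have Hk (k : 'I_m.+1) :
    cup_with j.+1 h m.+1 f (w \o bump (lift ord0 (lift ord0 k))) =
    (f 0 (w 1) (+) f 0 (w 0)) && cup_with j h m (f \o succn) (w \o succn \o bump (lift ord0 k)).
  by congr andb; apply: eq_cup_with => // i _; rewrite /= -bumpSS.
under eq_bigr => k _ do rewrite Hk.
rewrite xor_andl.
have := IH m (f \o succn) (w \o succn) Hj; rewrite big_ord_recl.
set s := bigop _ _ _; set a := cup_with j h m _ _ => Ha.
have -> : cup_prod m.+2 (upd f j.+1 h) w = (f 0 (w 1) (+) f 0 (w 0)) && (a (+) s).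
  by rewrite Ha.
rewrite /=.
have -> : cup_with j h m (f \o succn) ((w \o bump 0) \o succn) = a by [].
rewrite -/(bump 0 0) -/(bump 0 1) -/(bump 1 0) -/(bump 1 1).
rewrite (_ : bump 0 0 = 1) // (_ : bump 0 1 = 2) // (_ : bump 1 0 = 0) // (_ : bump 1 1 = 2) //.
by case: (f 0 _); case: (f 0 _); case: (f 0 _); case: (a); case: (s).
Qed.

(** Additivity in slot j: the difference of two counts that disagree in one label is again a cup
    product, with the sum of the two labels in that slot. *)
Lemma cup_prod_updD j m h1 h2 f w : j < m ->
  cup_prod m (upd f j h1) w (+) cup_prod m (upd f j h2) w =
  cup_prod m (upd f j (fun v => h1 v (+) h2 v)) w.
Proof.
elim: j m f w => [|j IH] [|m] f w //= Hj.
  have E h : cup_prod m (upd f 0 h \o succn) (w \o succn) = cup_prod m (f \o succn) (w \o succn).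
    by apply: eq_cup_prod.
  rewrite !E /upd /=; case: cup_prod; rewrite ?andbF ?andbT //.
  by do 2!case: (h1 _); do 2!case: (h2 _).
have E h : cup_prod m (upd f j.+1 h \o succn) (w \o succn) =
   cup_prod m (upd (f \o succn) j h) (w \o succn) by apply: eq_cup_prod.
rewrite !E -IH // /upd /=.
by rewrite andb_addr.
Qed.

End Cup.

Arguments cup_prod : simpl never.

(** Right multiplication by the odd [s] matches even with odd permutations, so the terms cancel in
    pairs. *)
Lemma xor_perm_eq0 n (s : 'S_n) (F : 'S_n -> bool) : odd_perm s ->
  (forall t, F (t * s)%g = F t) -> \big[addb/false]_t F t = false.
Proof.
move=> os FE; rewrite (bigID (fun t : 'S_n => odd_perm t)) /=.
rewrite (reindex_inj (mulIg s)) /=.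
under eq_bigl => t do rewrite odd_permM os addbT.
under eq_bigr => t _ do rewrite FE.
exact: addbb.
Qed.

(** * Parity count on the Freudenthal triangulation *)

Section Grid.
Variables (m p : nat).
Local Notation V := {ffun 'I_m.+1 -> nat}.
Local Notation cube := {ffun 'I_m.+1 -> 'I_p.+1}.

(* The simplices of the Freudenthal triangulation of the cube with lower corner x:
   t i is the time at which the path increases its i-th coordinate. *)
Definition cube_path n (x : {ffun 'I_n -> 'I_p.+1}) (t : 'S_n) (k : nat) : {ffun 'I_n -> nat} :=
  [ffun i => x i + (t i < k)].

Variables (j : 'I_m.+1) (h : V -> bool) (f : nat -> V -> bool).
Hypothesis h0 : forall v : V, v j = 0 \/ v j = p.+1 -> h v = false.
Hypothesis f0 : forall (i : 'I_m.+1) (v : V), v i = 0 -> f i v = false.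
Hypothesis f1 : forall (i : 'I_m.+1) (v : V), v i = p.+1 -> f i v = true.

Let le_jm : j <= m. Proof. by rewrite -ltnS. Qed.

(** If i = j, the factor [h] vanishes on the face; otherwise [f i] is constant on it, against
    [cup_with_jump]. *)
Lemma cup_with_face (i : 'I_m.+1) a (w : nat -> V) : a = 0 \/ a = p.+1 ->
  (forall l, l <= m -> w l i = a) -> cup_with j h m f w = false.
Proof.
move=> Ha Hw; apply/negP => Hc.
case: (eqVneq i j) => [Eij|nij].
  by have := cup_with_arg Hc; rewrite h0 // -Eij Hw // Eij.
have lim : i <= m by rewrite -ltnS.
have [b [d [Hb Hd]]] := cup_with_jump le_jm Hc lim nij.
by case: Ha Hw => -> Hw; rewrite ?(f0 (Hw _ Hb)) ?(f0 (Hw _ Hd)) ?(f1 (Hw _ Hb)) ?(f1 (Hw _ Hd)).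
Qed.

(** Omitting vertex k forgets which of the coordinates moved at times k - 1 and k moves before the
    other, so two paths of the same cube, differing by that transposition, share the facet. *)
Lemma inner_face_eq0 k (x : cube) : 0 < k <= m ->
  \big[addb/false]_(t : 'S_m.+1) cup_with j h m f (cube_path x t \o bump k) = false.
Proof.
case/andP => k0 km.
have Ek : (inord k : 'I_m.+1) = k :> nat by rewrite inordK.
have Ek1 : (inord k.-1 : 'I_m.+1) = k.-1 :> nat.
  by rewrite inordK // ltnS (leq_trans (leq_pred k)).
apply: (@xor_perm_eq0 _ (tperm (inord k.-1) (inord k))).
  rewrite odd_tperm; apply/eqP => /(congr1 val) /=; rewrite Ek Ek1.
  by case: (k) k0 => //= l _ /n_Sn.
move=> t; apply: eq_cup_with => // l _ /=; apply/ffunP => i; rewrite !ffunE permM.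
congr (_ + nat_of_bool _).
have Hl : bump k l != k by rewrite eq_sym neq_bump.
case: tpermP => [->|->|//]; rewrite Ek Ek1; move: (bump k l) Hl => b; case: k k0 {km Ek Ek1} => // k _ /= Hb.
- by rewrite [RHS]leq_eqVlt eq_sym (negPf Hb).
- by rewrite [LHS]leq_eqVlt eq_sym (negPf Hb).
Qed.

(* The facet of a simplex opposite to vertex 0 is the facet of the slid simplex
   opposite to its last vertex.  Base points wrap around: when that happens both
   facets lie in a face of the grid, where the cochain vanishes. *)
Definition slide (xt : cube * 'S_m.+1) : cube * 'S_m.+1 :=
  ([ffun i => if xt.2 i == ord0 then ordS (xt.1 i) else xt.1 i],
   (xt.2 * perm (@ord_pred_inj m.+1))%g).

Lemma slide_inj : injective slide.
Proof.
move=> [x t] [x' t'] [] /ffunP Hx /mulIg Ht; rewrite /= in Hx Ht.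
rewrite -{}Ht in Hx *; congr pair; apply/ffunP => i.
by have := Hx i; rewrite !ffunE /=; case: eqP => // _ /(can_inj (@ordSK _)).
Qed.

Lemma outer_face_eq xt :
  cup_with j h m f (cube_path xt.1 xt.2 \o bump 0) =
  cup_with j h m f (cube_path (slide xt).1 (slide xt).2 \o bump m.+1).
Proof.
case: xt => x t.
set i0 := (t^-1)%g ord0.
have ti0 : t i0 = ord0 by rewrite permKV.
have predE (i : 'I_m.+1) : ord_pred i = (if i == ord0 then m else i.-1) :> nat.
  case: i => -[|i] Hi /=; first by rewrite modn_small.
  by rewrite modnDr modn_small // ltnW.
have bE l : l <= m -> bump m.+1 l = l by move=> Hl; rewrite /bump leqNgt ltnS Hl.
case: (eqVneq (x i0) ord_max) => [xmax|xmax].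
  rewrite (@cup_with_face i0 p.+1); last 2 first.
  - by right.
  - by move=> l _; rewrite /= !ffunE ti0 xmax /= addn1.
  rewrite (@cup_with_face i0 0) //; first by left.
  move=> l lm; rewrite /= bE // !ffunE /= permM permE predE ti0 /= xmax /=.
  by rewrite modnn [m < l]ltnNge lm.
apply: eq_cup_with => // l lm; rewrite /= bE //; apply/ffunP => i; rewrite !ffunE /= permM permE predE.
case: eqP => [ti|/eqP ti].
  have Ei : i = i0 by rewrite /i0 -ti permK.
  rewrite ti [m < l]ltnNge lm addn0 /= Ei modn_small ?addn1 //.
  by rewrite ltnS ltn_neqAle -ltnS ltn_ord andbT.
congr (_ + nat_of_bool _); rewrite /bump /= add1n ltnS.
by case: (nat_of_ord (t i)) (ti : nat_of_ord (t i) != 0).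
Qed.

(** Stokes mod 2: by the Leibniz rule each term is a sum over facets. Inner facets cancel within a
    cube, and facets opposite to the first and to the last vertex cancel against each other through
    [slide]. *)
Lemma xor_cup_prod_upd_eq0 :
  \big[addb/false]_(x : cube) \big[addb/false]_(t : 'S_m.+1)
    cup_prod m.+1 (upd f j h) (cube_path x t) = false.
Proof.
under eq_bigr => x _ do under eq_bigr => t _ do rewrite -cup_with_leibniz //.
under eq_bigr => x _ do rewrite exchange_big /=.
rewrite exchange_big big_ord_recl big_ord_recr /=.
rewrite [X in _ (+) (X (+) _)]big1 ?addFb => [|k _]; last first.
  rewrite big1 // => x _; apply: inner_face_eq0.
  by rewrite /= /bump /= !add1n ltn_ord.
rewrite !pair_big /= [X in _ (+) X](reindex_inj slide_inj) /=.
under eq_bigr => xt _ do rewrite outer_face_eq.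
by rewrite addbb.
Qed.

End Grid.

(** The number of simplices along which label i changes exactly at step i, for every i, is shown to
    be odd. *)
Lemma kuhn_cube n p (f : 'I_n -> {ffun 'I_n -> nat} -> bool) :
  (forall i (v : {ffun 'I_n -> nat}), v i = 0 -> f i v = false) ->
  (forall i (v : {ffun 'I_n -> nat}), v i = p.+1 -> f i v = true) ->
  exists (x : {ffun 'I_n -> 'I_p.+1}) (t : 'S_n),
    forall i, f i (cube_path x t i.+1) != f i (cube_path x t i).
Proof.
case: n f => [|m] f f0 f1; first by exists [ffun=> ord0], 1%g => -[].
pose e i (v : {ffun 'I_m.+1 -> nat}) := v (inord i) == p.+1.
(* By xor_cup_prod_upd_eq0 the sum Q is unchanged when the labels are replaced one
   by one by the indicators e i of the upper faces, for which Q counts a single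
   simplex. *)
pose hyb l i := if i < l then e i else f (inord i).
pose Q F := \big[addb/false]_(x : {ffun 'I_m.+1 -> 'I_p.+1})
  \big[addb/false]_(t : 'S_m.+1) cup_prod m.+1 F (cube_path x t).
have QD F F' : (forall (x : {ffun 'I_m.+1 -> 'I_p.+1}) t, cup_prod m.+1 F (cube_path x t) = cup_prod m.+1 F' (cube_path x t)) -> Q F = Q F'.
  by move=> H; apply: eq_bigr => x _; apply: eq_bigr => t _; exact: H.
have hyb0 l i (v : {ffun 'I_m.+1 -> nat}) : v (inord i) = 0 -> hyb l i v = false.
  by move=> H; rewrite /hyb /e; case: ifP => _; [rewrite H|exact: f0].
have hyb1 l i (v : {ffun 'I_m.+1 -> nat}) : v (inord i) = p.+1 -> hyb l i v = true.
  by move=> H; rewrite /hyb /e; case: ifP => _; [rewrite H eqxx|exact: f1].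
have step l : l <= m -> Q (hyb l) = Q (hyb l.+1).
  move=> lm; apply/eqP; rewrite -[_ == _]negbK negb_eqb.
  have -> : Q (hyb l) = Q (upd (hyb l) l (f (inord l))).
    apply: QD => x t; apply: eq_cup_prod => // i _ v; rewrite /upd /hyb.
    by case: eqP => // ->; rewrite ltnn.
  have -> : Q (hyb l.+1) = Q (upd (hyb l) l (e l)).
    apply: QD => x t; apply: eq_cup_prod => // i _ v; rewrite /upd /hyb ltnS leq_eqVlt.
    by case: eqP => // ->.
  rewrite -big_split /=.
  under eq_bigr => x _ do rewrite -big_split /=.
  under eq_bigr => x _ do under eq_bigr => t _ do rewrite cup_prod_updD //.
  have El : l = (inord l : 'I_m.+1) by rewrite inordK.
  (* The sum of the two labels can serve as the cochain [h]: both satisfy the same boundary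
     conditions in direction l, so it vanishes on the two faces there. *)
  rewrite [X in upd _ X _]El xor_cup_prod_upd_eq0 //.
  - by move=> v [] Hv; rewrite /e Hv ?(f0 _ _ Hv) ?(f1 _ _ Hv) ?eqxx.
  - by move=> i v Hv; rewrite hyb0 // inord_val.
  - by move=> i v Hv; rewrite hyb1 // inord_val.
have Qall l : l <= m.+1 -> Q (hyb 0) = Q (hyb l).
  elim: l => [_|l IH lm]; first reflexivity.
  by rewrite (IH (ltnW lm)) (step l).
(* The indicator [e i] changes at step i only if coordinate i is the one moved at that step and
   reaches p + 1; this forces the identity order in the last cube. *)
have cupe (x : {ffun 'I_m.+1 -> 'I_p.+1}) t : cup_prod m.+1 e (cube_path x t) = (x == [ffun=> ord_max]) && (t == 1%g).
  apply/cup_prodP/andP => [H|[/eqP -> /eqP ->] i im]; last first.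
    by rewrite /e !ffunE perm1 inordK // ltnn ltnSn /= addn0 addn1 eqxx (ltn_eqF (ltnSn p)).
  have Ht (i : 'I_m.+1) : t i = i /\ x i = ord_max.
    have := H i (ltn_ord i); rewrite /e !ffunE inord_val ltnS.
    case: ltngtP => [_|_|/val_inj Ei]; rewrite ?eqxx //.
    rewrite addn0 addn1 eqSS => Hx; split => //; apply/val_inj => /=.
    by move: Hx; rewrite (ltn_eqF (ltn_ord (x i))) eqbF_neg negbK => /eqP.
  by split; apply/eqP; [apply/ffunP => i; rewrite ffunE; case: (Ht i)
                       |apply/permP => i; rewrite perm1; case: (Ht i)].
have Qe : Q (hyb m.+1).
  rewrite (@QD _ e); last first.
    by move=> x t; apply: eq_cup_prod => // i im v; rewrite /hyb im.
  rewrite /Q (bigD1 [ffun=> ord_max]) //= [X in _ (+) X]big1 ?addbF => [|x Hx]; last first.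
    by rewrite big1 // => t _; rewrite cupe (negPf Hx).
  rewrite (bigD1 1%g) //= cupe !eqxx /= big1 // => t Ht.
  by rewrite cupe (negPf Ht) andbF.
have : Q (hyb 0) by rewrite (Qall m.+1).
have [[x [t Hc]] _|Hn] := pselect (exists (x : {ffun 'I_m.+1 -> 'I_p.+1}) t, cup_prod m.+1 (hyb 0) (cube_path x t)).
  exists x, t => i; have /cup_prodP/(_ i (ltn_ord i)) := Hc.
  by rewrite /hyb /= inord_val.
rewrite /Q big1 // => x _; rewrite big1 // => t _; apply/negP => Hc.
by apply: Hn; exists x, t.
Qed.

Local Open Scope classical_set_scope.
Local Open Scope ring_scope.

(** * Euclidean norm *)

Section EuclideanFacts.
Variable R : realType.

Lemma dotvE d (u v : 'cV[R]_d) : dotv u v = \sum_i u i 0 * v i 0.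
Proof. by rewrite /dotv mxE; apply: eq_bigr => i _; rewrite mxE. Qed.

Lemma dotvC d (u v : 'cV[R]_d) : dotv u v = dotv v u.
Proof. by rewrite !dotvE; apply: eq_bigr => i _; rewrite mulrC. Qed.

Lemma dotvDl d (u v w : 'cV[R]_d) : dotv (u + v) w = dotv u w + dotv v w.
Proof. by rewrite /dotv linearD /= mulmxDl mxE. Qed.

Lemma dotvDr d (u v w : 'cV[R]_d) : dotv w (u + v) = dotv w u + dotv w v.
Proof. by rewrite /dotv mulmxDr mxE. Qed.

Lemma dotvNl d (u w : 'cV[R]_d) : dotv (- u) w = - dotv u w.
Proof. by rewrite /dotv linearN /= mulNmx mxE. Qed.

Lemma dotvNr d (u w : 'cV[R]_d) : dotv w (- u) = - dotv w u.
Proof. by rewrite /dotv mulmxN mxE. Qed.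

Lemma dotvZl d a (u w : 'cV[R]_d) : dotv (a *: u) w = a * dotv u w.
Proof. by rewrite /dotv linearZ /= -scalemxAl mxE. Qed.

Lemma dotvZr d a (u w : 'cV[R]_d) : dotv w (a *: u) = a * dotv w u.
Proof. by rewrite /dotv -scalemxAr mxE. Qed.

Lemma dotv0l d (w : 'cV[R]_d) : dotv 0 w = 0.
Proof. by rewrite /dotv trmx0 mul0mx mxE. Qed.

Lemma dotv0r d (w : 'cV[R]_d) : dotv w 0 = 0.
Proof. by rewrite dotvC dotv0l. Qed.

Lemma dotv_trmx d e (A : 'M[R]_(d, e)) u v : dotv u (A *m v) = dotv (A^T *m u) v.
Proof. by rewrite /dotv trmx_mul trmxK mulmxA. Qed.

Lemma dotv_col d e (a b : 'cV[R]_d) (u v : 'cV[R]_e) :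
  dotv (col_mx a u) (col_mx b v) = dotv a b + dotv u v.
Proof. by rewrite /dotv tr_col_mx mul_row_col mxE. Qed.

Lemma enorm_ge0 d (v : 'cV[R]_d) : 0 <= enorm v.
Proof. exact: sqrtr_ge0. Qed.
Hint Resolve enorm_ge0 : core.

Lemma sqr_enorm d (v : 'cV[R]_d) : enorm v ^+ 2 = dotv v v.
Proof.
rewrite sqr_sqrtr; last by apply: sumr_ge0 => i _; apply: sqr_ge0.
by rewrite dotvE; apply: eq_bigr => i _; rewrite expr2.
Qed.

Lemma enorm0 d : enorm (0 : 'cV[R]_d) = 0.
Proof. by apply/eqP; rewrite -sqrf_eq0 sqr_enorm dotv0l. Qed.

Lemma enorm_coord d (v : 'cV[R]_d) i : `|v i 0| <= enorm v.
Proof.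
rewrite -sqrtr_sqr ler_wsqrtr // (bigD1 i) //= lerDl.
by apply: sumr_ge0 => j _; apply: sqr_ge0.
Qed.

Lemma enorm_eq0 d (v : 'cV[R]_d) : enorm v = 0 -> v = 0.
Proof.
move=> v0; apply/matrixP => i j; rewrite (ord1 j) mxE; apply/eqP.
by rewrite -normr_le0 -v0 enorm_coord.
Qed.

Lemma enormZ d a (v : 'cV[R]_d) : enorm (a *: v) = `|a| * enorm v.
Proof.
apply/eqP; rewrite -(@eqrXn2 _ 2) ?mulr_ge0 // sqr_enorm exprMn sqr_enorm.
by rewrite dotvZl dotvZr mulrA -expr2 real_normK ?num_real.
Qed.

Lemma enormN d (v : 'cV[R]_d) : enorm (- v) = enorm v.
Proof. by rewrite -scaleN1r enormZ normrN1 mul1r. Qed.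

Lemma enormB d (u v : 'cV[R]_d) : enorm (u - v) = enorm (v - u).
Proof. by rewrite -enormN opprB. Qed.

Lemma dotv_le d (u v : 'cV[R]_d) : dotv u v <= enorm u * enorm v.
Proof.
have [|u0] := eqVneq (enorm u) 0.
  by move=> /enorm_eq0 ->; rewrite dotv0l enorm0 mul0r.
have [|v0] := eqVneq (enorm v) 0.
  by move=> /enorm_eq0 ->; rewrite dotv0r enorm0 mulr0.
set a := enorm u; set b := enorm v.
have a0 : 0 < a by rewrite lt_neqAle eq_sym u0 enorm_ge0.
have b0 : 0 < b by rewrite lt_neqAle eq_sym v0 enorm_ge0.
have ab0 : 0 < a * b by rewrite mulr_gt0.
have : 0 <= enorm (b *: u - a *: v) ^+ 2 by exact: sqr_ge0.
rewrite sqr_enorm dotvDl !dotvDr !dotvNl !dotvNr !dotvZl !dotvZr -!sqr_enorm -/a -/b (dotvC v u).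
set s := dotv u v => H.
have : 0 <= 2 * (a * b) * (a * b - s) by move: H; rewrite !expr2; lra.
by rewrite pmulr_rge0 ?mulr_gt0 // subr_ge0.
Qed.

Lemma enormD d (u v : 'cV[R]_d) : enorm (u + v) <= enorm u + enorm v.
Proof.
rewrite -(@ler_pXn2r _ 2) ?nnegrE ?addr_ge0 // sqr_enorm dotvDl !dotvDr.
rewrite (dotvC v u) sqrrD -!sqr_enorm mulr2n.
have := dotv_le u v; lra.
Qed.

Lemma enormBD d (w u v : 'cV[R]_d) : enorm (u - v) <= enorm (u - w) + enorm (w - v).
Proof.
have -> : u - v = (u - w) + (w - v) by rewrite addrA subrK.
exact: enormD.
Qed.

Lemma enorm_col d e (u : 'cV[R]_d) (v : 'cV[R]_e) :
  enorm (col_mx u v) ^+ 2 = enorm u ^+ 2 + enorm v ^+ 2.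
Proof. by rewrite !sqr_enorm dotv_col. Qed.

Lemma enorm_col0 d e (u : 'cV[R]_d) : enorm (col_mx u (0 : 'cV[R]_e)) = enorm u.
Proof.
by apply/eqP; rewrite -(@eqrXn2 _ 2) // enorm_col enorm0 expr0n addr0.
Qed.

Lemma enorm_0col d e (u : 'cV[R]_d) : enorm (col_mx (0 : 'cV[R]_e) u) = enorm u.
Proof.
by apply/eqP; rewrite -(@eqrXn2 _ 2) // enorm_col enorm0 expr0n add0r.
Qed.

Lemma enorm_col_le d e (u : 'cV[R]_d) (v : 'cV[R]_e) :
  enorm (col_mx u v) <= enorm u + enorm v.
Proof.
by rewrite -[u in col_mx u _]addr0 -[v in col_mx _ v]add0r -add_col_mx
  (le_trans (enormD _ _)) // enorm_col0 enorm_0col.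
Qed.

Lemma enorm_usub d e (z : 'cV[R]_(d + e)) : enorm (usubmx z) <= enorm z.
Proof.
rewrite -(@ler_pXn2r _ 2) ?nnegrE // -[z in leRHS]vsubmxK enorm_col.
by rewrite lerDl sqr_ge0.
Qed.

Lemma enorm_dsub d e (z : 'cV[R]_(d + e)) : enorm (dsubmx z) <= enorm z.
Proof.
rewrite -(@ler_pXn2r _ 2) ?nnegrE // -[z in leRHS]vsubmxK enorm_col.
by rewrite lerDr sqr_ge0.
Qed.

Lemma enorm_le_coord d (v : 'cV[R]_d) e :
  (forall i, `|v i 0| <= e) -> enorm v <= d%:R * e.
Proof.
move=> H.
have -> : v = \sum_i v i 0 *: (delta_mx i 0 : 'cV[R]_d).
  rewrite [LHS]matrix_sum_delta; apply: eq_bigr => i _.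
  by rewrite big_ord_recl big_ord0 addr0.
have Hs (I : finType) (F : I -> 'cV[R]_d) :
    enorm (\sum_i F i) <= \sum_i enorm (F i).
  elim/big_ind2 : _ => [|x1 x2 y1 y2 h1 h2|//]; first by rewrite enorm0.
  by rewrite (le_trans (enormD _ _)) // lerD.
apply: (le_trans (Hs _ _)).
have -> : d%:R * e = \sum_(i < d) e by rewrite sumr_const card_ord mulr_natl.
apply: ler_sum => i _; rewrite enormZ.
have -> : enorm (delta_mx i 0 : 'cV[R]_d) = 1.
  apply/eqP; rewrite -(@eqrXn2 _ 2 _ 1) // sqr_enorm dotvE expr1n (bigD1 i) //= big1.
    by rewrite !mxE !eqxx mulr1 addr0.
  by move=> j ji; rewrite !mxE (negPf ji) mul0r.
by rewrite mulr1.
Qed.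

End EuclideanFacts.

(** * Brouwer's fixed point theorem on a box *)

Section Brouwer.
Variable R : realType.

Lemma mx_norm_le_enorm d (v : 'cV[R]_d) : `|v| <= enorm v.
Proof.
rewrite [leLHS]/Num.Def.normr /= mx_normrE; apply: bigmax_le => [|[i j] _ /=]; first exact: enorm_ge0.
by rewrite (ord1 j) enorm_coord.
Qed.

Lemma enorm_le_mx_norm d (v : 'cV[R]_d) : enorm v <= d%:R * `|v|.
Proof.
have Hc i : `|v i 0| <= `|v|.
  rewrite [leRHS]/Num.Def.normr /= mx_normrE.
  by apply/bigmax_geP; right; exists (i, 0).
have := normr_ge0 v; rewrite le_eqVlt => /predU1P[v0|v0]; last exact: enorm_le_coord.
suff -> : v = 0 by rewrite enorm0 normr0 mulr0.
by apply/eqP; rewrite -normr_eq0 -v0.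
Qed.

(** Transposition passes to row vectors, where closed bounded sets are compact. The cluster point
    form serves both the limit in Brouwer's theorem and that of the Picard iteration. *)
Lemma bolzano_weierstrass d (u : nat -> 'cV[R]_d) B : (forall k, enorm (u k) <= B) ->
  exists z, forall e, 0 < e -> forall K, exists2 k, (K <= k)%N & enorm (u k - z) < e.
Proof.
move=> uB.
pose A : set 'rV[R]_d := [set v | `|v| <= B].
have trn (v : 'cV[R]_d) : `|v^T| = `|v|.
  rewrite [LHS]/Num.Def.normr [RHS]/Num.Def.normr /= !mx_normrE.
  apply/eqP; rewrite eq_le; apply/andP; split; apply: bigmax_le.
  - by rewrite -mx_normrE; exact: (normr_ge0 v).
  - move=> [i j] _ /=; rewrite mxE.
    by apply/bigmax_geP; right; exists (j, i).
  - rewrite -mx_normrE; exact: (normr_ge0 v^T).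
  - move=> [i j] _ /=.
    by apply/bigmax_geP; right; exists (j, i) => //=; rewrite mxE.
have cA : compact A.
  apply: bounded_closed_compact.
    exists B; split; first exact: num_real.
    by move=> M BM v /= Av; apply: (le_trans Av); apply: ltW.
  have -> : A = Num.Def.normr @^-1` [set x | x <= B] by [].
  apply: closed_comp; last exact: closed_le.
  by move=> v _; apply: norm_continuous.
have [|z [_ clz]] := cA ((fun k => (u k)^T) @ \oo) _.
  by exists 0%N => // k _; rewrite /A /= trn (le_trans (mx_norm_le_enorm _)).
exists z^T => e e0 K.
pose e' := e / (d%:R + 1).
have d0 : 0 < d%:R + 1 :> R by rewrite ltr_wpDl.
have e'0 : 0 < e' by rewrite divr_gt0.
have [_ [[k Kk <-]]] := clz [set (u k)^T | k in [set k | (K <= k)%N]] (ball z e')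
   ltac:(exists K => // k Kk; exists k => //) (nbhsx_ballx z e' e'0).
rewrite -ball_normE /= => H; exists k => //.
apply: (le_lt_trans (enorm_le_mx_norm _)).
have -> : `|u k - z^T| = `|z - (u k)^T|.
  by rewrite -normrN opprB -trn linearB /= trmxK.
apply: (@le_lt_trans _ _ (d%:R * e')); first by rewrite ler_wpM2l // ltW.
by rewrite /e' mulrA ltr_pdivrMr // mulrC ltr_pM2l // ltrDl.
Qed.


Lemma invS_lt (e : R) : 0 < e -> exists K, forall k, (K <= k)%N -> k.+1%:R^-1 < e.
Proof.
move=> e0; exists (Num.truncn e^-1) => k Kk.
rewrite -[e]invrK ltf_pV2 ?posrE ?invr_gt0 ?ltr0n //.
have /Num.Theory.truncn_itv /andP[_ H] : 0 <= e^-1 by rewrite invr_ge0 ltW.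
by apply: (lt_le_trans H); rewrite ler_nat.
Qed.

Definition box d (c : 'cV[R]_d) r : set 'cV[R]_d :=
  [set z | forall i, `|z i 0 - c i 0| <= r].

Section Cube.
Variables (d : nat) (c : 'cV[R]_d) (r : R) (Phi : 'cV[R]_d -> 'cV[R]_d).
Hypothesis r_gt0 : 0 < r.
Hypothesis Phi_box : forall z, box c r z -> box c r (Phi z).

(** Label i tells whether [Phi] decreases coordinate i. On the simplex of Kuhn's lemma each label
    changes along some edge, whose end points are the required a and b; the whole simplex is smaller
    than e. *)
Lemma brouwer_approx e : 0 < e ->
  exists2 u, box c r u & forall i, exists a b,
    [/\ box c r a, box c r b, enorm (a - u) < e, enorm (b - u) < e &
        Phi a i 0 <= a i 0 /\ b i 0 <= Phi b i 0].
Proof.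
move=> e0.
have D0 : 0 < d.+1%:R * (2 * r) :> R by rewrite !mulr_gt0 // ltr0n.
(* The mesh is 2 * r / (p + 1), and d + 1 times the mesh stays below e; d + 1 in place of d keeps
   the divisor positive when d = 0. *)
have [p Hp] := invS_lt (divr_gt0 e0 D0); have {}Hp := Hp p (leqnn _).
pose N : R := p.+1%:R.
have N0 : 0 < N by rewrite ltr0n.
pose q (v : {ffun 'I_d -> nat}) : 'cV[R]_d := \col_i (c i 0 - r + 2 * r * (v i)%:R / N).
pose le (v : {ffun 'I_d -> nat}) := forall i : 'I_d, (v i <= p.+1)%N.
have qbox v : le v -> box c r (q v).
  move=> lv i; rewrite mxE ler_norml.
  have H0 : 0 <= (v i)%:R / N by rewrite divr_ge0 // ltW.
  have H1 : (v i)%:R / N <= 1 by rewrite ler_pdivrMr // mul1r ler_nat.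
  rewrite -!mulrA; move: H0 H1; set t := _ / N => H0 H1.
  have P0 : 0 <= r * t by rewrite mulr_ge0 // ltW.
  have P1 : r * t <= r by rewrite ger_pMr.
  by apply/andP; split; lra.
(* Forcing the label on the outer faces is harmless: there Phi points inwards. *)
pose f i (v : {ffun 'I_d -> nat}) := (v i == p.+1) || ((v i != 0%N) && (Phi (q v) i 0 < q v i 0)).
have [i v Hv|i v Hv|x [t Hxt]] := @kuhn_cube d p f.
- by rewrite /f Hv.
- by rewrite /f Hv eqxx.
have lev k : le (cube_path x t k).
  move=> i; rewrite ffunE; have := ltn_ord (x i); rewrite ltnS => H.
  by case: (_ < _)%N; rewrite ?addn1 ?addn0 // ltnW.
have near k : enorm (q (cube_path x t k) - q (cube_path x t 0)) < e.
  have h0 : 0 < 2 * r / N by rewrite !mulr_gt0 // invr_gt0.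
  apply: (@le_lt_trans _ _ (d%:R * (2 * r / N))).
    apply: enorm_le_coord => i; rewrite !mxE !ffunE ltn0 addn0 natrD.
    set X := (x i)%:R; case: (_ < _)%N; rewrite ?mulr0n ?mulr1n.
      have -> : c i 0 - r + 2 * r * (X + 1) / N - (c i 0 - r + 2 * r * X / N) = 2 * r / N by field; exact: lt0r_neq0.
      by rewrite ger0_norm // ltW.
    by rewrite addr0 subrr normr0 ltW.
  apply: (@lt_trans _ _ (d.+1%:R * (2 * r / N))); first by rewrite ltr_pM2r // ltr_nat.
  by rewrite mulrA -ltr_pdivlMl // mulrC.
have lab k i (b : bool) : f i (cube_path x t k) = b ->
   if b then Phi (q (cube_path x t k)) i 0 <= q (cube_path x t k) i 0
   else q (cube_path x t k) i 0 <= Phi (q (cube_path x t k)) i 0.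
  have := Phi_box (qbox _ (lev k)) i; rewrite ler_norml => /andP[h1 h2].
  rewrite /f; case: eqP => [Hv|_] /=.
    move=> <-; rewrite [X in _ <= X]mxE Hv mulfK ?lt0r_neq0 //; lra.
  case: eqP => [Hv|_] /=.
    by move=> <-; rewrite [X in X <= _]mxE Hv mulr0 mul0r addr0; lra.
  by move=> <-; case: ltP => // /ltW.
exists (q (cube_path x t 0)); first exact: qbox.
move=> i; have := Hxt i.
case E1 : (f i _); case E2 : (f i _) => // _; move/lab: E1 => /= E1; move/lab: E2 => /= E2.
- by exists (q (cube_path x t i.+1)), (q (cube_path x t i)); split; [exact: qbox|exact: qbox|exact: near|exact: near|].
- by exists (q (cube_path x t i)), (q (cube_path x t i.+1)); split; [exact: qbox|exact: qbox|exact: near|exact: near|].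
Qed.

Hypothesis Phi_cont : forall z, box c r z -> forall e, 0 < e -> exists2 dl, 0 < dl &
  forall z', box c r z' -> enorm (z' - z) < dl -> enorm (Phi z' - Phi z) < e.

(** At a cluster point of approximate solutions with vanishing precision, continuity turns the
    opposite inequalities at a and b into equality in each coordinate. *)
Theorem brouwer : exists2 z, box c r z & Phi z = z.
Proof.
have /choice[u Hu] (k : nat) : exists u, box c r u /\ forall i, exists a b,
    [/\ box c r a, box c r b, enorm (a - u) < k.+1%:R^-1, enorm (b - u) < k.+1%:R^-1 &
        Phi a i 0 <= a i 0 /\ b i 0 <= Phi b i 0].
  have [|u bu Hu] := @brouwer_approx k.+1%:R^-1; last by exists u.
  by rewrite invr_gt0 ltr0n.
have [|z Hz] := @bolzano_weierstrass d u (enorm c + d%:R * r).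
  move=> k; rewrite -[u k](subrK c) addrC (le_trans (enormD _ _)) // lerD2l.
  by apply: enorm_le_coord => i; rewrite !mxE; apply: (Hu k).1.
have bz : box c r z.
  move=> i; apply/ler_addgt0Pr => e e0; have [k _ Hk] := Hz e e0 0%N.
  have := (Hu k).1 i; have := enorm_coord (u k - z) i; rewrite !mxE.
  move=> h1 h2; rewrite -[z i 0](subKr (u k i 0)).
  have -> : u k i 0 - (u k i 0 - z i 0) - c i 0 = (u k i 0 - c i 0) - (u k i 0 - z i 0) by ring.
  by rewrite (le_trans (ler_normB _ _)) // lerD // ltW // (le_lt_trans h1).
exists z => //; apply/matrixP => i j; rewrite (ord1 j) {j}; apply/eqP; rewrite eq_le.
suff H e : 0 < e -> Phi z i 0 <= z i 0 + e /\ z i 0 <= Phi z i 0 + e.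
  by apply/andP; split; apply/ler_addgt0Pr => e e0; have [] := H e e0.
move=> e0; have e20 : 0 < e / 2 by rewrite divr_gt0.
have [dl dl0 Hdl] := Phi_cont bz e20.
pose m := Num.min dl (e / 2).
have m0 : 0 < m / 2 by rewrite divr_gt0 // lt_min dl0.
have [K HK] := invS_lt m0; have [k Kk Hk] := Hz _ m0 K.
have [_ /(_ i) [a [b [ba bb ha hb [ia ib]]]]] := Hu k.
have near v : enorm (v - u k) < k.+1%:R^-1 -> enorm (v - z) < m.
  move=> hv; apply: (le_lt_trans (enormBD (u k) v z)).
  by rewrite (splitr m) ltrD // (lt_trans hv) // HK.
have pt v : box c r v -> enorm (v - u k) < k.+1%:R^-1 ->
  `|Phi v i 0 - Phi z i 0| <= e / 2 /\ `|v i 0 - z i 0| <= e / 2.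
  move=> bv /near; rewrite lt_min => /andP[/(Hdl _ bv) h1 h2].
  have := enorm_coord (Phi v - Phi z) i; have := enorm_coord (v - z) i; rewrite !mxE.
  by move=> h3 h4; split; apply: ltW; [apply: (le_lt_trans h4)|apply: (le_lt_trans h3)].
have [] := pt _ ba ha; have [] := pt _ bb hb; rewrite !ler_norml.
move=> /andP[? ?] /andP[? ?] /andP[? ?] /andP[? ?]; split; lra.
Qed.

End Cube.
End Brouwer.

(** * Jacobians and the mean value inequality *)

Section Derivative.
Variable R : realType.

Lemma mx_norm_entry m n (A : 'M[R]_(m, n)) i j : `|A i j| <= `|A|.
Proof.
rewrite [leRHS]/Num.Def.normr /= mx_normrE.
by apply/bigmax_geP; right; exists (i, j).
Qed.

Lemma mulmx_bound m n (A : 'M[R]_(m, n)) v :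
  enorm (A *m v) <= m%:R * (n%:R * `|A|) * enorm v.
Proof.
rewrite -mulrA; apply: enorm_le_coord => i; rewrite mxE.
apply: (le_trans (ler_norm_sum _ _ _)).
have -> : n%:R * `|A| * enorm v = \sum_(j < n) `|A| * enorm v.
  by rewrite sumr_const card_ord -[RHS]mulr_natl mulrA.
apply: ler_sum => j _; rewrite normrM ler_pM // ?mx_norm_entry //.
exact: enorm_coord.
Qed.

Lemma opnorm_bound m n (A : 'M[R]_(m, n)) v : enorm (A *m v) <= opnorm A * enorm v.
Proof.
have ub (w : 'cV[R]_n) : enorm w <= 1 -> enorm (A *m w) <= opnorm A.
  move=> w1; apply: sup_upper_bound; last by exists w.
  split; first by exists (enorm (A *m w)); exists w.
  exists (m%:R * (n%:R * `|A|)) => _ [u /= u1 <-].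
  by apply: (le_trans (mulmx_bound A u)); rewrite ler_piMr.
have [|v0] := eqVneq (enorm v) 0.
  by move=> /[dup] /enorm_eq0 -> ->; rewrite mulmx0 enorm0 mulr0.
have v1 : 0 < enorm v by rewrite lt_neqAle eq_sym v0 enorm_ge0.
rewrite -ler_pdivrMr //.
have := ub ((enorm v)^-1 *: v); rewrite enormZ ger0_norm ?invr_ge0 ?enorm_ge0 //.
by rewrite mulVf // => /(_ (lexx _)); rewrite -scalemxAr enormZ ger0_norm ?invr_ge0 ?enorm_ge0 // mulrC.
Qed.

(** Frechet derivative in the Euclidean norm, the derivative being a matrix; equivalence of norms
    links it to the differential taken in the maximum norm. *)
Definition fder d e (f : 'cV[R]_d -> 'cV[R]_e) x (A : 'M[R]_(e, d)) : Prop :=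
  forall eps, 0 < eps -> exists2 dl, 0 < dl & forall h, enorm h < dl ->
    enorm (f (x + h) - f x - A *m h) <= eps * enorm h.

Lemma differentiable_ball (V W : normedModType R) (f : V -> W) x : differentiable f x ->
  forall eps, 0 < eps -> exists2 dl, 0 < dl & forall h, `|h| < dl ->
    `|f (x + h) - f x - 'd f x h| <= eps * `|h|.
Proof.
move=> /diff_locally /eqaddoP H eps eps0.
have /nbhs_ballP [dl /= dl0 Hdl] := H eps eps0; exists dl => // h hdl.
have -> : f (x + h) - f x - 'd f x h = (f \o shift x - (cst (f x) + 'd f x)) h.
  by rewrite -[RHS]/(f (h + x) - (f x + 'd f x h)) opprD addrA [h + x]addrC.
by apply: Hdl; rewrite -ball_normE /= sub0r normrN.
Qed.

Lemma jac_mul d e (f : 'cV[R]_d -> 'cV[R]_e) x h :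
  jac f x *m h = 'd f x h.
Proof.
have {2}-> : h = \sum_j h j 0 *: (delta_mx j 0 : 'cV[R]_d).
  rewrite [LHS]matrix_sum_delta; apply: eq_bigr => i _.
  by rewrite big_ord_recl big_ord0 addr0.
apply/matrixP => i j; rewrite (ord1 j) mxE linear_sum summxE.
by apply: eq_bigr => k _; rewrite linearZ !mxE mulrC.
Qed.

Lemma enorm_le_of_mx_norm d e (u : 'cV[R]_d) (h : 'cV[R]_e) eps : 0 < eps ->
  `|u| <= eps / (d%:R + 1) * `|h| -> enorm u <= eps * enorm h.
Proof.
move=> eps0 H; apply: (le_trans (enorm_le_mx_norm _)).
have d1 : 0 < d%:R + 1 :> R by rewrite ltr_wpDl.
apply: (le_trans (ler_wpM2l (ler0n _ _) H)).
apply: (@le_trans _ _ (eps * `|h|)); last by rewrite ler_pM2l // mx_norm_le_enorm.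
rewrite mulrA ler_wpM2r // mulrCA ger_pMr // ler_pdivrMr // mul1r lerDl //.
Qed.

Lemma differentiable_fder d e (f : 'cV[R]_d -> 'cV[R]_e) x :
  differentiable f x -> fder f x (jac f x).
Proof.
move=> df eps eps0.
have d1 : 0 < e%:R + 1 :> R by rewrite ltr_wpDl.
have [dl dl0 H] := differentiable_ball df (divr_gt0 eps0 d1); exists dl => // h hdl.
rewrite jac_mul; apply: enorm_le_of_mx_norm => //; apply: H.
exact: (le_lt_trans (mx_norm_le_enorm _)).
Qed.

Lemma linear_mx_continuous m n (V : normedModType R) (f : {linear 'M[R]_(m, n) -> V}) :
  continuous f.
Proof.
apply/linear_bounded_continuous/bounded_funP => r.
exists (\sum_i \sum_j (r * `|f (delta_mx i j)|)) => A Ar.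
rewrite [A]matrix_sum_delta linear_sum (le_trans (ler_norm_sum _ _ _)) //.
apply: ler_sum => i _; rewrite linear_sum (le_trans (ler_norm_sum _ _ _)) //.
apply: ler_sum => j _; rewrite linearZ normrZ ler_wpM2r //.
exact: (le_trans (mx_norm_entry _ _ _)).
Qed.

Lemma fder_diff (V W : normedModType R) (f : V -> W) x (L : {linear V -> W}) :
  continuous L ->
  (forall eps, 0 < eps -> exists2 dl, 0 < dl & forall h, `|h| < dl ->
    `|f (x + h) - f x - L h| <= eps * `|h|) ->
  differentiable f x /\ 'd f x = L :> (V -> W).
Proof.
move=> cL H.
have E : f \o shift x = cst (f x) + L +o_ 0 id.
  apply/eqaddoP => eps eps0; have [dl dl0 Hdl] := H eps eps0.
  apply/nbhs_ballP; exists dl => // h; rewrite -ball_normE /= sub0r normrN => hdl.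
  have -> : (f \o shift x - (cst (f x) + L)) h = f (x + h) - f x - L h.
    by rewrite -[LHS]/(f (h + x) - (f x + L h)) opprD addrA [h + x]addrC.
  exact: Hdl.
have D := diff_unique cL E; split => //.
by apply/diff_locallyP; rewrite D.
Qed.

Lemma fder_differentiable d e (f : 'cV[R]_d -> 'cV[R]_e) x A :
  fder f x A -> differentiable f x /\ jac f x = A.
Proof.
move=> fA.
have [||df dE] := @fder_diff _ _ f x (mulmx A).
- exact: linear_mx_continuous.
- move=> eps eps0.
  have d1 : 0 < d%:R + 1 :> R by rewrite ltr_wpDl.
  have [dl dl0 H] := fA _ (divr_gt0 eps0 d1); exists (dl / (d%:R + 1)).
    by rewrite divr_gt0.
  move=> h; rewrite ltr_pdivlMr // => hdl.
  have hh : enorm h <= (d%:R + 1) * `|h|.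
    by rewrite (le_trans (enorm_le_mx_norm _)) // ler_wpM2r // lerDl.
  apply: (le_trans (mx_norm_le_enorm _)).
  apply: (le_trans (H _ _)); first by rewrite (le_lt_trans hh) // mulrC.
  by rewrite -mulrA ler_pM2l // ler_pdivrMl.
split=> //; apply/matrixP => i j; rewrite mxE dE.
by have := colE j A => /matrixP /(_ i 0); rewrite mxE => <-.
Qed.

Lemma fderD d e (f g : 'cV[R]_d -> 'cV[R]_e) x A B :
  fder f x A -> fder g x B -> fder (fun z => f z + g z) x (A + B).
Proof.
move=> fA gB eps eps0.
have e20 : 0 < eps / 2 by rewrite divr_gt0.
have [d1 d10 H1] := fA _ e20; have [d2 d20 H2] := gB _ e20.
exists (Num.min d1 d2); first by rewrite lt_min d10.
move=> h; rewrite lt_min => /andP[/H1 h1 /H2 h2].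
rewrite (_ : _ - _ = (f (x + h) - f x - A *m h) + (g (x + h) - g x - B *m h)).
  by rewrite (le_trans (enormD _ _)) // [eps]splitr mulrDl lerD.
by rewrite mulmxDl; move: (A *m h) (B *m h) => a b; apply/matrixP => i j; rewrite !mxE; ring.
Qed.

Lemma fderZ d e (f : 'cV[R]_d -> 'cV[R]_e) x A a :
  fder f x A -> fder (fun z => a *: f z) x (a *: A).
Proof.
move=> fA eps eps0.
have a0 : 0 < `|a| + 1 by rewrite ltr_wpDl.
have [dl dl0 H] := fA _ (divr_gt0 eps0 a0); exists dl => // h /H hdl.
rewrite -scalemxAl -!scalerBr enormZ.
apply: (le_trans (ler_wpM2l (normr_ge0 _) hdl)).
rewrite mulrA ler_wpM2r ?enorm_ge0 // mulrCA ger_pMr // ler_pdivrMr // mul1r lerDl //.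
Qed.

Lemma fder_cst d e (v : 'cV[R]_e) (x : 'cV[R]_d) : fder (fun=> v) x 0.
Proof.
move=> eps eps0; exists 1 => // h _.
by rewrite subrr mul0mx subr0 enorm0 mulr_ge0 ?enorm_ge0 // ltW.
Qed.

Lemma eq_fder d e (f f' : 'cV[R]_d -> 'cV[R]_e) x A :
  f =1 f' -> fder f x A -> fder f' x A.
Proof. by move=> /funext <-. Qed.

Lemma fder_sum d e (I : finType) (f : I -> 'cV[R]_d -> 'cV[R]_e) x A :
  (forall i, fder (f i) x (A i)) -> fder (fun z => \sum_i f i z) x (\sum_i A i).
Proof.
move=> H; elim: (index_enum I) => [|i s IH].
  rewrite big_nil; apply: (eq_fder (f := fun=> 0)); last exact: fder_cst.
  by move=> z; rewrite big_nil.
rewrite big_cons; apply: (eq_fder (f := fun z => f i z + \sum_(i <- s) f i z)).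
  by move=> z; rewrite big_cons.
exact: fderD.
Qed.

Lemma fder_grad d e (f : 'cV[R]_d -> 'cV[R]_e) i x :
  differentiable (jac f) x -> fder (grad f i) x (hess f i x).
Proof.
move=> dJ; apply: differentiable_fder.
pose LL : {linear 'M[R]_(e, d) -> 'cV[R]_d} := trmx \o row i.
rewrite (_ : grad f i = LL \o jac f) //.
by apply: differentiable_comp => //; apply: linear_differentiable; apply: linear_mx_continuous.
Qed.

Lemma jac_continuous d e (f : 'cV[R]_d -> 'cV[R]_e) x :
  differentiable (jac f) x -> forall eps, 0 < eps -> exists2 dl, 0 < dl &
  forall h, enorm h < dl -> (forall v, enorm ((jac f (x + h) - jac f x) *m v) <= eps * enorm v) /\
    (forall v, enorm ((jac f (x + h) - jac f x)^T *m v) <= eps * enorm v).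
Proof.
move=> /differentiable_continuous /cvgrPdist_lt H eps eps0.
pose k : R := e%:R * d%:R + 1.
have k0 : 0 < k by rewrite ltr_wpDl // mulr_ge0.
have /nbhs_ballP[dl /= dl0 Hdl] := H _ (divr_gt0 eps0 k0).
exists dl => // h hdl.
have : `|jac f (x + h) - jac f x| < eps / k.
  rewrite -normrN opprB; apply: Hdl; rewrite -ball_normE /= opprD addNKr normrN.
  exact: (le_lt_trans (mx_norm_le_enorm _)).
set D := _ - _ => HD.
have bnd m n (A : 'M[R]_(m, n)) v : m%:R * n%:R <= k -> `|A| <= `|D| ->
    enorm (A *m v) <= eps * enorm v.
  move=> mk AD; apply: (le_trans (mulmx_bound A v)); rewrite ler_wpM2r ?enorm_ge0 //.
  rewrite mulrA; apply: (@le_trans _ _ (k * `|D|)).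
    by rewrite ler_pM // mulr_ge0.
  by rewrite ltW // -ltr_pdivlMl // mulrC.
split=> v; apply: bnd; rewrite ?lerDl //.
- by rewrite mulrC lerDl.
- rewrite [leLHS]/Num.Def.normr /= mx_normrE; apply: bigmax_le => // -[i j] _ /=.
  by rewrite mxE mx_norm_entry.
Qed.

(** The scalar mean value theorem is applied to the component along the error vector w itself: it
    gives [enorm w ^+ 2] as the product of w with (D - A) dz at an intermediate point, and
    Cauchy-Schwarz allows division by [enorm w]. *)
Lemma fder_mvt d e (f : 'cV[R]_d -> 'cV[R]_e) (D : 'cV[R]_d -> 'M[R]_(e, d)) A z1 z2 eta :
  (forall z, fder f z (D z)) ->
  (forall t, 0 < t < 1 -> forall v,
     enorm ((D (z2 + t *: (z1 - z2)) - A) *m v) <= eta * enorm v) ->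
  enorm (f z1 - f z2 - A *m (z1 - z2)) <= eta * enorm (z1 - z2).
Proof.
move=> fD H; set w := (X in enorm X <= _); set dz := z1 - z2 in w H *.
pose psi (t : R) := dotv w (f (z2 + t *: dz) - t *: (A *m dz)).
pose dpsi (t : R) := dotv w ((D (z2 + t *: dz) - A) *m dz).
have der (t : R) : is_derive t (1 : R) psi (dpsi t).
  pose c := dpsi t.
  have cL : continuous ( *%R^~ c : R -> R) by move=> y; apply: mulrr_continuous.
  have mc_lin : linear ( *%R^~ c : R -> R).
    by move=> a x y; rewrite mulrDl -scalerAl.
  pose mcL := GRing.isLinear.Build _ _ _ _ _ mc_lin.
  pose LL : {linear R -> R} := HB.pack ( *%R^~ c : R -> R) mcL.
  have [||dp pE] := @fder_diff _ _ psi t LL.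
  - exact: cL.
  - move=> eps eps0.
    pose k := enorm w * enorm dz + 1.
    have k0 : 0 < k by rewrite ltr_wpDl // mulr_ge0 // enorm_ge0.
    have [dl dl0 Hdl] := fD (z2 + t *: dz) _ (divr_gt0 eps0 k0).
    have dz1 : 0 < enorm dz + 1 by rewrite ltr_wpDl // enorm_ge0.
    exists (dl / (enorm dz + 1)); first by rewrite divr_gt0.
    move=> h; rewrite ltr_pdivlMr // => hdl.
    have hh : enorm (h *: dz) < dl.
      rewrite enormZ; apply: le_lt_trans hdl; rewrite ler_wpM2l // lerDl //.
    have {Hdl} := Hdl _ hh; set r := (X in enorm X <= _) => Hr.
    have -> : psi (t + h) - psi t - LL h = dotv w r.
      rewrite /psi /= /c /dpsi [h * _]mulrC.
      rewrite mulrC -dotvZr -!dotvNr -!dotvDr; congr dotv.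
      rewrite /r scalerDl addrA -scalemxAr scalerDl mulmxBl scalerBr.
      apply/matrixP => i j; rewrite !mxE; ring.
    apply: (@le_trans _ _ (enorm w * enorm r)).
      rewrite ler_norml dotv_le andbT lerNl -dotvNr.
      by rewrite (le_trans (dotv_le _ _)) // enormN.
    apply: (le_trans (ler_wpM2l (enorm_ge0 _) Hr)); rewrite enormZ.
    have -> : enorm w * (eps / k * (`|h| * enorm dz)) = eps * `|h| * ((enorm w * enorm dz) / k) by ring.
    apply: ler_piMr; first by rewrite mulr_ge0 // ltW.
    by rewrite ler_pdivrMr // mul1r lerDl.
  apply: DeriveDef; first exact/diff_derivable.
  by rewrite deriveE // pE /= mul1r.
have [|t t01 E] := @MVT R psi dpsi 0 1 ltr01.
  apply: continuous_subspaceT => t; apply: differentiable_continuous.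
  by apply/derivable1_diffP; case: (der t).
move: t01; rewrite in_itv /= => t01.
have : enorm w ^+ 2 = dpsi t.
  have <- : psi 1 - psi 0 = dpsi t by rewrite E subr0 mulr1.
  rewrite sqr_enorm /psi -dotvNr -dotvDr; congr dotv.
  by rewrite !scale1r !scale0r addr0 subr0 /dz addrCA subrr addr0 addrAC.
move=> Ew.
have [->|w0] := eqVneq (enorm w) 0.
  have := H t t01 dz; apply: le_trans; exact: enorm_ge0.
have w1 : 0 < enorm w by rewrite lt_neqAle eq_sym w0 enorm_ge0.
rewrite -(ler_pM2l w1) -expr2 Ew (le_trans (dotv_le _ _)) // ler_pM2l //.
exact: H.
Qed.

End Derivative.

(** * Fixed points of the strong regularity map *)

Section StrongRegularity.
Variables (R : realType) (d : nat).
Variables (T : 'cV[R]_d -> set 'cV[R]_d) (zbar : 'cV[R]_d).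
Variables (gamma rho rdelta : R) (zs : 'cV[R]_d -> 'cV[R]_d).
Hypothesis gamma_gt0 : 0 < gamma.
Hypothesis rho_gt0 : 0 < rho.
Hypothesis rdelta_gt0 : 0 < rdelta.
Hypothesis zsE : forall delta, eball 0 rdelta delta ->
  eball zbar rho `&` [set z | T z delta] = [set zs delta].
Hypothesis zs_lip : forall delta1 delta2, eball 0 rdelta delta1 -> eball 0 rdelta delta2 ->
  enorm (zs delta1 - zs delta2) <= gamma * enorm (delta1 - delta2).
Hypothesis T_zbar : T zbar 0.

Lemma zs_spec delta : eball 0 rdelta delta -> T (zs delta) delta /\ eball zbar rho (zs delta).
Proof. by move/zsE/seteqP => [_ /(_ (zs delta) erefl)] []. Qed.

Lemma zs_unique delta z : eball 0 rdelta delta -> eball zbar rho z -> T z delta -> z = zs delta.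
Proof. by move/zsE/seteqP => [H _] bz Tz; apply: (H z); split. Qed.

Lemma eball_center k (x : 'cV[R]_k) r : 0 < r -> eball x r x.
Proof. by rewrite /eball /= subrr enorm0. Qed.

Lemma zs0 : zs 0 = zbar.
Proof. by apply/esym/zs_unique => //; apply: eball_center. Qed.

Lemma zs_dist delta : eball 0 rdelta delta -> enorm (zs delta - zbar) <= gamma * enorm delta.
Proof.
by move=> Hd; have := zs_lip Hd (eball_center 0 rdelta_gt0); rewrite zs0 subr0.
Qed.

Section Contraction.
Variables (e : 'cV[R]_d -> 'cV[R]_d) (r L q : R).
Hypothesis r_rho : r <= rho.
Hypothesis r_rdelta : r <= gamma * rdelta.
Hypothesis L_ge0 : 0 <= L.
Hypothesis gammaL : gamma * L <= q.
Hypothesis q_lt1 : q < 1.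
Hypothesis r_gt0 : 0 < r.
Hypothesis e_lip : forall z1 z2, eball zbar r z1 -> eball zbar r z2 ->
  enorm (e z1 - e z2) <= L * enorm (z1 - z2).
(** Budget for the self-map property: the centre moves by less than (1 - q) * r and Lipschitz growth
    adds at most q * r. With [r_rdelta] it also keeps the gaps inside the perturbation ball. *)
Hypothesis e_zbar : gamma * enorm (e zbar) < (1 - q) * r.

Let q_ge0 : 0 <= q. Proof. by apply: le_trans gammaL; rewrite mulr_ge0 // ltW. Qed.

Let e_bound z : eball zbar r z -> gamma * enorm (e z) <= gamma * enorm (e zbar) + q * enorm (z - zbar).
Proof.
move=> bz; apply: (@le_trans _ _ (gamma * (enorm (e zbar) + L * enorm (z - zbar)))).
  rewrite ler_pM2l // -[in leLHS](subrK (e zbar) (e z)) addrC.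
  rewrite (le_trans (enormD _ _)) // lerD2l e_lip //; exact: eball_center.
by rewrite mulrDr lerD2l mulrA ler_wpM2r // enorm_ge0.
Qed.

Let e_small z : eball zbar r z -> eball 0 rdelta (e z).
Proof.
move=> bz; rewrite /eball /= subr0 -(ltr_pM2l gamma_gt0).
apply: lt_le_trans r_rdelta; apply: (le_lt_trans (e_bound bz)).
have : q * enorm (z - zbar) <= q * r by rewrite ler_wpM2l // ltW.
move: e_zbar; lra.
Qed.

Let sub_rho z : eball zbar r z -> eball zbar rho z.
Proof. by move=> H; apply: lt_le_trans r_rho. Qed.

(** Both points are values of [zs], so their distance is at most gamma times [enorm (e z1 - delta)];
    passing through [e z2] and absorbing the Lipschitz term leaves the factor 1 - q. With delta =
    [e z2] this is uniqueness, with another delta an error bound. *)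
Lemma solution_lip z1 z2 : eball zbar r z1 -> eball zbar r z2 ->
  T z1 (e z1) -> forall delta, eball 0 rdelta delta -> T z2 delta ->
  (1 - q) * enorm (z1 - z2) <= gamma * enorm (e z2 - delta).
Proof.
move=> b1 b2 T1 dl bd T2.
rewrite [in leLHS](zs_unique (e_small b1) (sub_rho b1) T1) [in leLHS](zs_unique bd (sub_rho b2) T2).
have H := zs_lip (e_small b1) bd.
have H2 : enorm (e z1 - dl) <= L * enorm (z1 - z2) + enorm (e z2 - dl).
  by rewrite (le_trans (enormBD (e z2) _ _)) // lerD2r e_lip.
have E : enorm (z1 - z2) = enorm (zs (e z1) - zs dl).
  by rewrite -(zs_unique (e_small b1) (sub_rho b1) T1) -(zs_unique bd (sub_rho b2) T2).
rewrite {}E in H2; move: H H2; set a := enorm (zs _ - _) => H H2.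
have a0 : 0 <= a := enorm_ge0 _.
have H3 : gamma * enorm (e z1 - dl) <= gamma * (L * a + enorm (e z2 - dl)) by rewrite ler_pM2l.
have H4 : (gamma * L) * a <= q * a by rewrite ler_wpM2r.
move: H H3 H4; rewrite mulrDr mulrA; lra.
Qed.

Lemma contraction_solution : exists z',
  eball zbar r `&` [set z | T z (e z)] = [set z'] /\
  (1 - q) * enorm (z' - zbar) <= gamma * enorm (e zbar).
Proof.
(* The closed ball of radius s is invariant and s < r, so the limit cannot leave the open ball of
   radius r. *)
pose s := gamma * enorm (e zbar) / (1 - q).
have q1 : 0 < 1 - q by rewrite subr_gt0.
have s0 : 0 <= s by rewrite divr_ge0 ?mulr_ge0 ?enorm_ge0 // ltW.
have sr : s < r by rewrite ltr_pdivrMr // [r * _]mulrC.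
have sE : gamma * enorm (e zbar) = s * (1 - q) by rewrite divfK // gt_eqF.
pose u k := iter k (zs \o e) zbar.
have uB k : enorm (u k - zbar) <= s.
  elim: k => [|k IH]; first by rewrite subrr enorm0.
  have bu : eball zbar r (u k) by apply: le_lt_trans sr.
  apply: (le_trans (zs_dist (e_small bu))).
  apply: (le_trans (e_bound bu)); rewrite sE.
  have := ler_wpM2l q_ge0 IH; lra.
have ub k : eball zbar r (u k) by apply: le_lt_trans sr.
have Phi_lip z1 z2 : eball zbar r z1 -> eball zbar r z2 ->
    enorm (zs (e z1) - zs (e z2)) <= q * enorm (z1 - z2).
  move=> b1 b2; apply: (le_trans (zs_lip (e_small b1) (e_small b2))).
  apply: (le_trans (ler_wpM2l (ltW gamma_gt0) (e_lip b1 b2))).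
  by rewrite mulrA ler_wpM2r // enorm_ge0.
have uS k : enorm (u k.+1 - u k) <= q ^+ k * s.
  elim: k => [|k IH]; first by rewrite expr0 mul1r (uB 1%N).
  have -> : u k.+2 - u k.+1 = zs (e (u k.+1)) - zs (e (u k)) by [].
  by apply: (le_trans (Phi_lip _ _ (ub _) (ub _))); rewrite exprS -mulrA ler_wpM2l.
(* A cluster point replaces the limit of a Cauchy sequence: since consecutive iterates approach each
   other, it is already a fixed point. *)
have [|z Hz] := @bolzano_weierstrass R d u (enorm zbar + s).
  by move=> k; rewrite -[u k](subrK zbar) addrC (le_trans (enormD _ _)) // lerD2l.
have zB : enorm (z - zbar) <= s.
  apply/ler_addgt0Pr => eps eps0; have [k _ Hk] := Hz _ eps0 0%N.
  apply: (le_trans (enormBD (u k) z zbar)); rewrite addrC lerD ?uB //.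
  by rewrite enormB ltW.
have bz : eball zbar r z by apply: le_lt_trans sr.
have zfix : zs (e z) = z.
  apply/eqP; rewrite -subr_eq0; apply/eqP/enorm_eq0/eqP.
  rewrite eq_le enorm_ge0 andbT; apply/ler_addgt0Pr => eps eps0; rewrite add0r.
  have e30 : 0 < eps / 3 by rewrite divr_gt0.
  have [K HK] : exists K, forall k, (K <= k)%N -> q ^+ k * s < eps / 3.
    have s1 : 0 < s + 1 by rewrite ltr_wpDl.
    have := @cvg_expr R q; rewrite ger0_norm // => /(_ q_lt1).
    move=> /cvgrPdist_lt /(_ _ (divr_gt0 e30 s1)) [K _ HK]; exists K => k Kk.
    have := HK k Kk; rewrite sub0r normrN ger0_norm ?exprn_ge0 // ltr_pdivlMr //.
    by apply: le_lt_trans; rewrite ler_wpM2l ?exprn_ge0 // lerDl.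
  have [k Kk Hk] := Hz _ e30 K.
  have h1 := enormBD (zs (e (u k))) (zs (e z)) z.
  have h2 := enormBD (u k) (zs (e (u k))) z.
  have h3 := uS k; have h4 := HK k Kk.
  have h5 := Phi_lip _ _ bz (ub k).
  have h6 : q * enorm (z - u k) <= enorm (u k - z) by rewrite enormB ler_piMl ?enorm_ge0 // ltW.
  have uE : u k.+1 = zs (e (u k)) by [].
  rewrite uE in h3; lra.
exists z; split; last first.
  by rewrite sE mulrC ler_pM2r.
apply/seteqP; split=> [w [bw Tw]|_ ->] /=; last first.
  by split=> //; rewrite -{1}zfix; case: (zs_spec (e_small bz)).
have Tz : T z (e z) by rewrite -{1}zfix; case: (zs_spec (e_small bz)).
have := solution_lip bw bz Tw (e_small bz) Tz; rewrite subrr enorm0 mulr0.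
rewrite pmulr_rle0 // => H; apply/eqP; rewrite -subr_eq0; apply/eqP/enorm_eq0/eqP.
by rewrite eq_le H enorm_ge0.
Qed.

End Contraction.

(** The Euclidean bound on [zs (e z) - zbar] bounds each coordinate, so the map sends the box into
    itself; it is continuous because [zs] is Lipschitz. The strict r < gamma * rdelta puts the gaps
    in the open perturbation ball. *)
Lemma brouwer_solution e r :
  0 < r -> r < gamma * rdelta ->
  (forall z, box zbar r z -> gamma * enorm (e z) <= r) ->
  (forall z, forall eps, 0 < eps -> exists2 dl, 0 < dl &
     forall h, enorm h < dl -> enorm (e (z + h) - e z) < eps) ->
  exists z, T z (e z).
Proof.
move=> r0 r1 e_le e_cont.
have e_small z : box zbar r z -> eball 0 rdelta (e z).
  by move=> bz; rewrite /eball /= subr0 -(ltr_pM2l gamma_gt0) (le_lt_trans (e_le _ bz)).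
have [| |z bz zE] := @brouwer R d zbar r (zs \o e) r0.
- move=> z bz i; have := enorm_coord (zs (e z) - zbar) i; rewrite !mxE => /le_trans; apply.
  by apply: (le_trans (zs_dist (e_small _ bz))); apply: e_le.
- move=> z bz eps eps0; have [dl dl0 Hdl] := e_cont z _ (divr_gt0 eps0 gamma_gt0).
  exists dl => // z' bz' Hz'.
  apply: (le_lt_trans (zs_lip (e_small _ bz') (e_small _ bz))).
  rewrite -ltr_pdivlMl // mulrC.
  by have := Hdl (z' - z) Hz'; rewrite [z + _]addrC subrK.
- by exists z; rewrite -{1}zE; case: (zs_spec (e_small _ bz)).
Qed.

End StrongRegularity.

(** * The KKT system and the subproblems *)

Section Cones.
Variable R : realType.

Lemma normal_cone_sub0 d (S : set 'cV[R]_d) z a :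
  (exists2 u, normal_cone S z u & a + u = 0) <-> normal_cone S z (- a).
Proof.
split=> [[u Nu /eqP]|N]; last by exists (- a); rewrite ?subrr.
by rewrite addrC addr_eq0 => /eqP <-.
Qed.

Variables (n m p : nat).
Variables (c : 'cV[R]_n) (g : 'cV[R]_n -> 'cV[R]_m) (M : 'M[R]_(m, p)).
Variable Omega : set 'cV[R]_n.

(** The multiplier block is unconstrained: testing with the point whose second block is moved by
    [dsubmx u] gives [- enorm (dsubmx u) ^+ 2 >= 0]. *)
Lemma normal_cone_Kset (z u : 'cV[R]_(n + m)) :
  normal_cone (Kset Omega) z u <->
  normal_cone Omega (usubmx z) (usubmx u) /\ dsubmx u = 0.
Proof.
split=> [[Kz H]|[[Oz H] u0]]; last first.
  split=> // v Kv; rewrite -[u]vsubmxK u0 -[z - v]vsubmxK dotv_col dotv0l addr0.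
  by rewrite linearB; apply: H.
split.
  split=> // v Ov; have := H (col_mx v (dsubmx z)); rewrite /Kset /= col_mxKu => /(_ Ov).
  rewrite -[u]vsubmxK -[z in dotv _ (z - _)]vsubmxK opp_col_mx add_col_mx subrr.
  by rewrite dotv_col dotv0r addr0 col_mxKu.
have := H (col_mx (usubmx z) (dsubmx z + dsubmx u)); rewrite /Kset /= col_mxKu => /(_ Kz).
rewrite -[u]vsubmxK -[z in dotv _ (z - _)]vsubmxK opp_col_mx add_col_mx subrr.
rewrite dotv_col dotv0r add0r opprD addrA subrr add0r dotvNr col_mxKd -sqr_enorm oppr_ge0.
move=> H1; apply: enorm_eq0; apply/eqP; rewrite -sqrf_eq0 eq_le H1; exact: sqr_ge0.
Qed.

Lemma ZstarE xi z : Zstar c g M Omega xi z <->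
  normal_cone (Kset Omega) z (- (Fmap c g z + Cmat n M *m xi)).
Proof. exact: normal_cone_sub0. Qed.

Lemma LinvE delta zbar xi z : Linv c g M Omega delta zbar xi z <->
  normal_cone (Kset Omega) z
    (delta - (Fmap c g zbar + jac (Fmap c g) zbar *m (z - zbar) + Cmat n M *m xi)).
Proof.
split=> [[u Nu <-]|N]; first by rewrite [_ + u]addrC addrK.
by eexists; first exact: N; rewrite addrC subrK.
Qed.

(* The map of the generalized equation of the subproblem, without the term C xi. *)
Definition sub_map (xk : 'cV[R]_n) (H : 'M[R]_n) (z : 'cV[R]_(n + m)) : 'cV[R]_(n + m) :=
  col_mx (c + H *m (usubmx z - xk) + (jac g xk)^T *m dsubmx z)
         (g xk + jac g xk *m (usubmx z - xk)).

Lemma Cmat_mul xi : Cmat n M *m xi = col_mx (0 : 'cV[R]_n) (M *m xi).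
Proof. by rewrite mul_col_mx mul0mx. Qed.

Lemma sub_kktE xk H xi z : sub_kkt c g M Omega xk H xi z <->
  normal_cone (Kset Omega) z (- (sub_map xk H z + Cmat n M *m xi)).
Proof.
rewrite normal_cone_Kset /sub_map Cmat_mul add_col_mx addr0 opp_col_mx col_mxKu col_mxKd.
split=> [[/normal_cone_sub0 N L]|[N /eqP L]]; split=> //.
- by rewrite L oppr0.
- exact/normal_cone_sub0.
- by apply/eqP; rewrite -oppr_eq0.
Qed.

Hypothesis g_diff2 : twice_differentiable g.

Definition jacF (z : 'cV[R]_(n + m)) : 'M[R]_(n + m) :=
  block_mx (hessL g z) (jac g (usubmx z))^T (jac g (usubmx z)) 0.

Lemma fder_Jty x (y : 'cV[R]_m) :
  fder (fun x => (jac g x)^T *m y) x (\sum_(i < m) y i 0 *: hess g i x).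
Proof.
have -> : (fun x => (jac g x)^T *m y) = (fun x => \sum_(i < m) y i 0 *: grad g i x).
  apply/funext => x'; apply/matrixP => i j; rewrite (ord1 j) mxE summxE.
  by apply: eq_bigr => k _; rewrite !mxE mulrC.
by apply: fder_sum => i; apply: fderZ; apply: fder_grad; case: g_diff2.
Qed.

Lemma jacF_mul z (h : 'cV[R]_(n + m)) : jacF z *m h =
  col_mx (hessL g z *m usubmx h + (jac g (usubmx z))^T *m dsubmx h)
         (jac g (usubmx z) *m usubmx h).
Proof. by rewrite -[in LHS](vsubmxK h) mul_block_col mul0mx addr0. Qed.

Let linearization_error (A1 A0 : 'M[R]_(m, n)) (W : 'M[R]_n) (b h1 : 'cV[R]_n) (y h2 : 'cV[R]_m) :
  b + A1^T *m (y + h2) - (b + A0^T *m y) - (W *m h1 + A0^T *m h2) =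
  A1^T *m y - A0^T *m y - W *m h1 + (A1 - A0)^T *m h2.
Proof.
have -> : (A1 - A0)^T = A1^T - A0^T by apply/matrixP => i j; rewrite !mxE.
rewrite mulmxDr mulmxBl.
move: (A1^T *m y) (A1^T *m h2) (A0^T *m y) (W *m h1) (A0^T *m h2) => *.
by apply/matrixP => i j; rewrite !mxE; ring.
Qed.

(** Product rule for J(x)^T y: the mixed term, a difference of Jacobians applied to the increment of
    y, is o(h) by continuity of the Jacobian; the other two terms are first-order remainders. *)
Lemma fder_Fmap z : fder (Fmap c g) z (jacF z).
Proof.
move=> eps eps0; set x := usubmx z; set y := dsubmx z.
have e30 : 0 < eps / 3 by rewrite divr_gt0.
have [d1 d10 H1] := fder_Jty x y e30.
have [d2 d20 H2] := jac_continuous (g_diff2.2 x) e30.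
have [d3 d30 H3] := differentiable_fder (g_diff2.1 x) e30.
exists (Num.min d1 (Num.min d2 d3)); first by rewrite !lt_min d10 d20.
move=> h; rewrite !lt_min => /and3P[h1 h2 h3].
have hu : enorm (usubmx h) <= enorm h := enorm_usub h.
have hd : enorm (dsubmx h) <= enorm h := enorm_dsub h.
have {H1} := H1 _ (le_lt_trans hu h1); have [_ {H2}] := H2 _ (le_lt_trans hu h2).
have {H3} := H3 _ (le_lt_trans hu h3).
set a3 := (X in enorm X <= _) => H3 /(_ (dsubmx h)).
set a2 := (X in enorm X <= _) => H2.
set a1 := (X in enorm X <= _) => H1.
have -> : Fmap c g (z + h) - Fmap c g z - jacF z *m h = col_mx (a1 + a2) a3.
  rewrite jacF_mul /Fmap (linearD usubmx) (linearD dsubmx) -/x -/y.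
  rewrite !opp_col_mx !add_col_mx /a3; congr col_mx.
  exact: linearization_error.
rewrite (le_trans (enorm_col_le _ _)) //.
have h0 := enorm_ge0 h.
have E3 : enorm a3 <= eps / 3 * enorm h by rewrite (le_trans H3) // ler_pM2l.
have E2 : enorm a2 <= eps / 3 * enorm h by rewrite (le_trans H2) // ler_pM2l.
have E1 : enorm a1 <= eps / 3 * enorm h by rewrite (le_trans H1) // ler_pM2l.
have := enormD a1 a2; lra.
Qed.

Lemma jac_Fmap z : jac (Fmap c g) z = jacF z.
Proof. by case: (fder_differentiable (fder_Fmap z)). Qed.

Lemma Fmap_continuous z eps : 0 < eps -> exists2 dl, 0 < dl &
  forall h, enorm h < dl -> enorm (Fmap c g (z + h) - Fmap c g z) < eps.
Proof.
move=> eps0; have [d1 d10 H1] := fder_Fmap z ltr01.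
pose k := 1 + `|opnorm (jacF z)|.
have k0 : 0 < k by rewrite ltr_wpDr.
exists (Num.min d1 (eps / k)); first by rewrite lt_min d10 divr_gt0.
move=> h; rewrite lt_min ltr_pdivlMr // => /andP[/H1 h1 h2].
have h3 : enorm (jacF z *m h) <= `|opnorm (jacF z)| * enorm h.
  by rewrite (le_trans (opnorm_bound _ _)) // ler_wpM2r ?enorm_ge0 // ler_norm.
apply: le_lt_trans h2; rewrite -[X in enorm X](subrK (jacF z *m h)).
by rewrite (le_trans (enormD _ _)) // /k mulrDr mulr1 mulrC lerD // -[leRHS]mul1r.
Qed.

End Cones.

(** * Convexity of the KKT set of a subproblem *)

Section SubproblemConvex.
Variables (R : realType) (n m p : nat).
Variables (c : 'cV[R]_n) (g : 'cV[R]_n -> 'cV[R]_m) (M : 'M[R]_(m, p)).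
Variable Omega : set 'cV[R]_n.
Variables (xk : 'cV[R]_n) (H : 'M[R]_n) (xi : 'cV[R]_p).
Hypothesis Omega_convex : convex_set Omega.
Hypothesis H_psd : psd H.

(** Monotonicity: with a1, a2 the gradients of the Lagrangian, the cone conditions give a2 . dx <= 0
    <= a1 . dx, while J dx = 0 and positive semidefiniteness give (a2 - a1) . dx >= 0. Hence both
    products vanish, and the cone conditions carry over to the segment. *)
Lemma sub_kkt_convex z1 z2 t : 0 <= t <= 1 ->
  sub_kkt c g M Omega xk H xi z1 -> sub_kkt c g M Omega xk H xi z2 ->
  sub_kkt c g M Omega xk H xi (z1 + t *: (z2 - z1)).
Proof.
move=> /andP[t0 t1] [/normal_cone_sub0 K1 L1] [/normal_cone_sub0 K2 L2].
case: K1 => O1 N1; case: K2 => O2 N2.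
set x1 := usubmx z1 in O1 N1 L1; set x2 := usubmx z2 in O2 N2 L2.
set y1 := dsubmx z1 in N1; set y2 := dsubmx z2 in N2.
pose a x y := c + H *m (x - xk) + (jac g xk)^T *m y.
pose dx := x2 - x1.
have JJ : jac g xk *m dx = 0.
  have : g xk + jac g xk *m (x2 - xk) + M *m xi = g xk + jac g xk *m (x1 - xk) + M *m xi.
    by rewrite [LHS]L2 [RHS]L1.
  move=> /addIr /addrI /eqP; rewrite -subr_eq0 -mulmxBr opprB addrA subrK.
  by move=> /eqP.
have ab : dotv (a x2 y2 - a x1 y1) dx = dotv dx (H *m dx).
  have -> : a x2 y2 - a x1 y1 = H *m dx + (jac g xk)^T *m (y2 - y1).
    rewrite /a !mulmxBr; move: (_ *m y2) (_ *m y1) (_ *m x2) (_ *m x1) (_ *m xk) => *.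
    by apply/matrixP => i j; rewrite !mxE; ring.
  by rewrite dotvDl -dotv_trmx JJ dotv0r addr0 dotvC.
have := N1 _ O2; have := N2 _ O1; rewrite -/(a _ _) -/(a _ _) !dotvNl.
have -> : x1 - x2 = - dx by rewrite opprB.
rewrite -/dx !dotvNr opprK => q2 q1.
have q0 : 0 <= dotv dx (H *m dx) by case: H_psd.
rewrite -ab dotvDl dotvNl in q0.
have e1 : dotv (a x1 y1) dx = 0 by lra.
have e2 : dotv (a x2 y2) dx = 0 by lra.
have ux : usubmx (z1 + t *: (z2 - z1)) = x1 + t *: dx by rewrite linearD linearZ linearB.
have uy : dsubmx (z1 + t *: (z2 - z1)) = y1 + t *: (y2 - y1) by rewrite linearD linearZ linearB.
split; last first.
  rewrite ux /sub_linearized /=.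
  have -> : jac g xk *m (x1 + t *: dx - xk) = jac g xk *m (x1 - xk).
    by rewrite addrAC mulmxDr -scalemxAr JJ scaler0 addr0.
  exact: L1.
rewrite ux uy; apply/normal_cone_sub0; rewrite -/(a _ _); split.
  have := Omega_convex (Itv01 t0 t1) (mem_set O2) (mem_set O1); rewrite inE.
  congr (Omega _); rewrite /conv /= -/x1 -/x2 /dx scalerBr scalerBl scale1r.
  exact: addrCA.
have aE : a (x1 + t *: dx) (y1 + t *: (y2 - y1)) = (1 - t) *: a x1 y1 + t *: a x2 y2.
  rewrite /a /dx !(mulmxDr, mulmxBr, mulmxN) -!scalemxAr !(mulmxDr, mulmxN).
  move: (_ *m y2) (_ *m y1) (_ *m x2) (_ *m x1) (_ *m xk) => *.
  by apply/matrixP => i j; rewrite !mxE; ring.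
move=> v Ov; rewrite aE dotvNl dotvDl !dotvZl.
have v1 := N1 _ Ov; have v2 := N2 _ Ov.
rewrite -/(a _ _) in v1; rewrite -/(a _ _) in v2.
have E1 : dotv (a x1 y1) (x1 + t *: dx - v) = dotv (a x1 y1) (x1 - v).
  have -> : x1 + t *: dx - v = (x1 - v) + t *: dx by rewrite addrAC.
  by rewrite dotvDr dotvZr e1 mulr0 addr0.
have E2 : dotv (a x2 y2) (x1 + t *: dx - v) = dotv (a x2 y2) (x2 - v).
  have -> : x1 + t *: dx - v = (x2 - v) + (t - 1) *: dx.
    by rewrite /dx; apply/matrixP => i j; rewrite !mxE; ring.
  by rewrite dotvDr dotvZr e2 mulr0 addr0.
rewrite E1 E2; move: v1 v2; rewrite !dotvNl !oppr_ge0 => v1 v2.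
rewrite -[leRHS](addr0 0) lerD //; first by rewrite mulr_ge0_le0 // subr_ge0.
by rewrite mulr_ge0_le0.
Qed.

(* The point z' + t (z - z') is a KKT point in the ball for small t > 0. *)
Lemma sub_kkt_global zbar r z' z : eball zbar r `&` sub_kkt c g M Omega xk H xi = [set z'] ->
  sub_kkt c g M Omega xk H xi z -> z = z'.
Proof.
move=> /seteqP [U /(_ z' erefl) [bz' Kz']] Kz.
have [/enorm_eq0/eqP|nz] := eqVneq (enorm (z - z')) 0; first by rewrite subr_eq0 => /eqP.
have n0 : 0 < enorm (z - z') by rewrite lt_neqAle eq_sym nz enorm_ge0.
have s0 : 0 < r - enorm (z' - zbar) by rewrite subr_gt0.
pose t := Num.min 1 ((r - enorm (z' - zbar)) / (2 * enorm (z - z'))).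
have t0 : 0 < t by rewrite lt_min ltr01 divr_gt0 // mulr_gt0.
have t1 : t <= 1 by rewrite ge_min lexx.
have tn : t * enorm (z - z') < r - enorm (z' - zbar).
  apply: (@le_lt_trans _ _ ((r - enorm (z' - zbar)) / (2 * enorm (z - z')) * enorm (z - z'))).
    by rewrite ler_pM2r // ge_min lexx orbT.
  rewrite invfM mulrA divfK ?gt_eqF // ltr_pdivrMr //; lra.
have /U : (eball zbar r `&` sub_kkt c g M Omega xk H xi) (z' + t *: (z - z')).
  split; last by apply: sub_kkt_convex; rewrite // t1 ltW.
  rewrite /eball /= addrAC (le_lt_trans (enormD _ _)) // enormZ gtr0_norm //.
  by move: tn; lra.
move=> /= /eqP; rewrite -subr_eq0 addrAC subrr add0r scaler_eq0 gt_eqF //= subr_eq0.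
by move/eqP.
Qed.

End SubproblemConvex.

Lemma usubmxB (R : realType) n m (a b : 'cV[R]_(n + m)) :
  usubmx (a - b) = usubmx a - usubmx b.
Proof. by apply/matrixP => i j; rewrite !mxE. Qed.

Lemma dsubmxB (R : realType) n m (a b : 'cV[R]_(n + m)) :
  dsubmx (a - b) = dsubmx a - dsubmx b.
Proof. by apply/matrixP => i j; rewrite !mxE. Qed.

Lemma jacF_mul_col0 (R : realType) n m (g : 'cV[R]_n -> 'cV[R]_m) z (h : 'cV[R]_n) :
  jacF g z *m col_mx h (0 : 'cV[R]_m) = col_mx (hessL g z *m h) (jac g (usubmx z) *m h).
Proof. by rewrite jacF_mul col_mxKu col_mxKd mulmx0 addr0. Qed.

Lemma dsub_block_sub (R : realType) n m (A A' : 'M[R]_n) (B B' : 'M[R]_(m, n)) (v : 'cV[R]_n) :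
  dsubmx ((block_mx A B^T B 0 - block_mx A' B'^T B' 0) *m col_mx v (0 : 'cV[R]_m)) =
  (B - B') *m v.
Proof.
by rewrite opp_block_mx add_block_mx mul_block_col col_mxKd mulmx0 addr0.
Qed.

Lemma usub_block_sub (R : realType) n m (A A' : 'M[R]_n) (B B' : 'M[R]_(m, n)) (v : 'cV[R]_m) :
  usubmx ((block_mx A B^T B 0 - block_mx A' B'^T B' 0) *m col_mx (0 : 'cV[R]_n) v) =
  (B - B')^T *m v.
Proof.
rewrite opp_block_mx add_block_mx mul_block_col col_mxKu mulmx0 add0r.
by congr (_ *m _); apply/matrixP => i j; rewrite !mxE.
Qed.

Lemma col_mx_sub3 (R : realType) n m (c a1 a2 w : 'cV[R]_n) (b1 b2 v : 'cV[R]_m) :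
  col_mx (c + a1) b1 - col_mx (c + a2) b2 - col_mx w v =
  col_mx (a1 - a2 - w) (b1 - b2 - v).
Proof.
by rewrite !opp_col_mx !add_col_mx; congr (col_mx (_ - _) _); rewrite opprD addrACA subrr add0r.
Qed.

(** * Linearization gaps and the residual of the subproblem *)

Section Residuals.
Variables (R : realType) (n m p : nat).
Variables (c : 'cV[R]_n) (g : 'cV[R]_n -> 'cV[R]_m) (M : 'M[R]_(m, p)).
Variable Omega : set 'cV[R]_n.
Variables (zbar : 'cV[R]_(n + m)) (xi : 'cV[R]_p).
Hypothesis g_diff2 : twice_differentiable g.

Let xb := usubmx zbar.
Let yb := dsubmx zbar.
Let W := hessL g zbar.
Let F := Fmap c g.
Let C := Cmat n M.

Definition linearized z := F zbar + jacF g zbar *m (z - zbar) + C *m xi.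
Definition exact_gap xi' z := linearized z - (F z + C *m xi').
Definition sub_gap xk H xi' z := linearized z - (sub_map c g xk H z + C *m xi').

Let T z delta := Linv c g M Omega delta zbar xi z.

Lemma Linv_exact_gap xi' z : Zstar c g M Omega xi' z <-> T z (exact_gap xi' z).
Proof.
rewrite ZstarE /T LinvE jac_Fmap // /exact_gap -/(linearized z).
by have -> : linearized z - (F z + C *m xi') - linearized z = - (F z + C *m xi') by rewrite addrAC subrr add0r.
Qed.

Lemma Linv_sub_gap xk H xi' z : sub_kkt c g M Omega xk H xi' z <-> T z (sub_gap xk H xi' z).
Proof.
rewrite sub_kktE /T LinvE jac_Fmap // /sub_gap -/(linearized z).
by have -> a : linearized z - a - linearized z = - a by rewrite addrAC subrr add0r.
Qed.

Lemma exact_gap_zbar xi' : exact_gap xi' zbar = C *m (xi - xi').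
Proof. by rewrite /exact_gap /linearized subrr mulmx0 addr0 mulmxBr opprD addrACA subrr add0r. Qed.

Lemma exact_gap_sub xi' z1 z2 : exact_gap xi' z1 - exact_gap xi' z2 = - (F z1 - F z2 - jacF g zbar *m (z1 - z2)).
Proof.
have -> : z1 - z2 = (z1 - zbar) - (z2 - zbar) by rewrite opprB addrA subrK.
rewrite /exact_gap /linearized [jacF g zbar *m (_ - (z2 - zbar))]mulmxBr.
move: (jacF g zbar *m (z1 - zbar)) (jacF g zbar *m (z2 - zbar)) (C *m xi) (C *m xi') (F z1) (F z2) (F zbar) => *.
by apply/matrixP => i j; rewrite !mxE; ring.
Qed.

Lemma sub_gap_sub xk H xi' z1 z2 : sub_gap xk H xi' z1 - sub_gap xk H xi' z2 =
  col_mx ((W - H) *m (usubmx z1 - usubmx z2) -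
            (jac g xk - jac g xb)^T *m (dsubmx z1 - dsubmx z2))
         (- ((jac g xk - jac g xb) *m (usubmx z1 - usubmx z2))).
Proof.
have trB (A B : 'M[R]_(m, n)) : (A - B)^T = A^T - B^T by apply/matrixP => i j; rewrite !mxE.
have -> : sub_gap xk H xi' z1 - sub_gap xk H xi' z2 =
   jacF g zbar *m (z1 - zbar) - jacF g zbar *m (z2 - zbar) - (sub_map c g xk H z1 - sub_map c g xk H z2).
  rewrite /sub_gap /linearized; move: (jacF g zbar *m _) (jacF g zbar *m _) (C *m _) (C *m _) (sub_map _ _ _ _ _) (sub_map _ _ _ _ _) (F zbar) => *.
  by apply/matrixP => i j; rewrite !mxE; ring.
rewrite -mulmxBr opprB addrA subrK jacF_mul usubmxB dsubmxB /sub_map.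
rewrite !opp_col_mx !add_col_mx opp_col_mx add_col_mx -/xb -/W trB.
move: (usubmx z1) (usubmx z2) (dsubmx z1) (dsubmx z2) (jac g xk) (jac g xb) W => x1 x2 y1 y2 Jk Jb W'.
congr col_mx.
  rewrite !mulmxBl !mulmxBr.
  move: (W' *m x1) (W' *m x2) (H *m x1) (H *m x2) (H *m xk) (Jk^T *m y1) (Jk^T *m y2) (Jb^T *m y1) (Jb^T *m y2) => *.
  by apply/matrixP => i j; rewrite !mxE; ring.
rewrite !mulmxBl !mulmxBr.
move: (Jk *m x1) (Jk *m x2) (Jk *m xk) (Jb *m x1) (Jb *m x2) (g xk) => *.
by apply/matrixP => i j; rewrite !mxE; ring.
Qed.

(** First-order remainder of F between two primal points with the multiplier frozen at that of
    [zbar]; it collects the remainders of the constraint and of the Lagrangian gradient, so bounds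
    on F near [zbar] apply to both at once. *)
Definition linearization_gap x1 x2 :=
  F (col_mx x1 yb) - F (col_mx x2 yb) - jacF g zbar *m (col_mx x1 yb - col_mx x2 yb).

Let linearization_gapE x1 x2 : linearization_gap x1 x2 =
  col_mx ((jac g x1)^T *m yb - (jac g x2)^T *m yb - W *m (x1 - x2))
         (g x1 - g x2 - jac g xb *m (x1 - x2)).
Proof.
have -> : linearization_gap x1 x2 = F (col_mx x1 yb) - F (col_mx x2 yb) - jacF g zbar *m col_mx (x1 - x2) 0.
  by congr (_ - _ *m _); rewrite opp_col_mx add_col_mx subrr.
have FE x : F (col_mx x yb) = col_mx (c + (jac g x)^T *m yb) (g x).
  by rewrite /F /Fmap col_mxKu col_mxKd.
rewrite (FE x1) (FE x2) jacF_mul_col0 -/xb -/W.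
exact: col_mx_sub3.
Qed.

Lemma residual_split xk H v : F v - sub_map c g xk H v =
  linearization_gap (usubmx v) xk +
  col_mx ((W - H) *m (usubmx v - xk) + (jac g (usubmx v) - jac g xk)^T *m (dsubmx v - yb))
         (- ((jac g xk - jac g xb) *m (usubmx v - xk))).
Proof.
have trB (A B : 'M[R]_(m, n)) : (A - B)^T = A^T - B^T by apply/matrixP => i j; rewrite !mxE.
rewrite linearization_gapE /F /Fmap /sub_map trB.
move: (usubmx v) (dsubmx v) (g _) (g xk) (jac g _) (jac g xk) (jac g xb) W => xv yv gv gk Jv Jk Jb W'.
rewrite opp_col_mx !add_col_mx; congr col_mx.
  rewrite !mulmxBl !mulmxBr.
  move: (W' *m xv) (W' *m xk) (H *m xv) (H *m xk) (Jk^T *m yv) (Jk^T *m yb) (Jv^T *m yv) (Jv^T *m yb) => *.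
  by apply/matrixP => i j; rewrite !mxE; ring.
rewrite !mulmxBl !mulmxBr.
move: (Jk *m xv) (Jk *m xk) (Jb *m xv) (Jb *m xk) => *.
by apply/matrixP => i j; rewrite !mxE; ring.
Qed.

Lemma sub_gap_exact_gap xk H xi' v : sub_gap xk H xi' v - exact_gap xi' v = F v - sub_map c g xk H v.
Proof.
rewrite /sub_gap /exact_gap; move: (linearized v) (sub_map _ _ _ _ _) (F v) (C *m xi') => *.
by apply/matrixP => i j; rewrite !mxE; ring.
Qed.

(** Both off-diagonal blocks of the KKT matrix are controlled, hence one bound for the Jacobian and
    one for its transpose. *)
Definition jac_near x eta :=
  (forall v, enorm ((jac g x - jac g xb) *m v) <= eta * enorm v) /\
  (forall v, enorm ((jac g x - jac g xb)^T *m v) <= eta * enorm v).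

(** Each of the two off-diagonal blocks contributes one eta. *)
Lemma sub_gap_lip xk H xi' kappa eta z1 z2 : opnorm (W - H) <= kappa -> jac_near xk eta ->
  0 <= kappa -> 0 <= eta ->
  enorm (sub_gap xk H xi' z1 - sub_gap xk H xi' z2) <= (kappa + 2 * eta) * enorm (z1 - z2).
Proof.
move=> WH [J1 J2] k0 e0; rewrite sub_gap_sub.
set x := usubmx z1 - _; set y := dsubmx z1 - _.
have xz : enorm x <= enorm (z1 - z2).
  have -> : x = usubmx (z1 - z2) by rewrite usubmxB.
  exact: enorm_usub.
have yz : enorm y <= enorm (z1 - z2).
  have -> : y = dsubmx (z1 - z2) by rewrite dsubmxB.
  exact: enorm_dsub.
have h1 : enorm ((W - H) *m x) <= kappa * enorm (z1 - z2).
  by rewrite (le_trans (opnorm_bound _ _)) // (le_trans (ler_wpM2r (enorm_ge0 _) WH)) // ler_wpM2l.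
have h2 : enorm ((jac g xk - jac g xb)^T *m y) <= eta * enorm (z1 - z2).
  by rewrite (le_trans (J2 _)) // ler_wpM2l.
have h3 : enorm ((jac g xk - jac g xb) *m x) <= eta * enorm (z1 - z2).
  by rewrite (le_trans (J1 _)) // ler_wpM2l.
apply: (le_trans (enorm_col_le _ _)); rewrite enormN.
have := enormD ((W - H) *m x) (- ((jac g xk - jac g xb)^T *m y)); rewrite enormN.
lra.
Qed.

Lemma residual_le xk H v kappa eta e1 e2 : opnorm (W - H) <= kappa -> jac_near xk eta ->
  enorm (linearization_gap (usubmx v) xk) <= e1 ->
  enorm ((jac g (usubmx v) - jac g xk)^T *m (dsubmx v - yb)) <= e2 ->
  enorm (F v - sub_map c g xk H v) <=
    (kappa + eta) * enorm (usubmx v - xk) + e1 + e2.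
Proof.
move=> WH [J1 J2] h1 h2; rewrite residual_split.
apply: (le_trans (enormD _ _)).
set x := usubmx v - xk in h1 h2 *.
set a := (_^T *m _) in h2 *.
have h3 : enorm ((W - H) *m x) <= kappa * enorm x.
  by rewrite (le_trans (opnorm_bound _ _)) // (ler_wpM2r (enorm_ge0 _) WH).
have := enorm_col_le ((W - H) *m x + a) (- ((jac g xk - jac g xb) *m x)).
rewrite enormN; have := J1 x; have := enormD ((W - H) *m x) a; lra.
Qed.

Lemma jac_near_sub x1 x2 eta1 eta2 w : jac_near x1 eta1 -> jac_near x2 eta2 ->
  enorm ((jac g x1 - jac g x2)^T *m w) <= (eta1 + eta2) * enorm w.
Proof.
move=> [_ J1] [_ J2].
have -> : (jac g x1 - jac g x2)^T *m w =
    (jac g x1 - jac g xb)^T *m w - (jac g x2 - jac g xb)^T *m w.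
  rewrite -mulmxBl; congr (_ *m _); move: (jac g x1) (jac g x2) (jac g xb) => *.
  by apply/matrixP => i j; rewrite !mxE; ring.
apply: (le_trans (enormD _ _)); rewrite enormN mulrDl.
by apply: lerD; [apply: J1|apply: J2].
Qed.

End Residuals.

Lemma opp_linearization (R : realType) d e (a b : 'cV[R]_e) (D : 'M[R]_(e, d)) (u v : 'cV[R]_d) :
  - (a - b - D *m (u - v)) = b - a - D *m (v - u).
Proof. by rewrite -(opprB u v) mulmxN opprK opprD opprB opprK. Qed.

(** * Local solvability and the error bound *)

Section Local.
Variables (R : realType) (n m p : nat).
Variables (c : 'cV[R]_n) (g : 'cV[R]_n -> 'cV[R]_m) (M : 'M[R]_(m, p)).
Variable Omega : set 'cV[R]_n.
Variables (zbar : 'cV[R]_(n + m)) (xi : 'cV[R]_p).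
Variables gamma rbz rbdelta kappa q mu : R.
Hypothesis g_diff2 : twice_differentiable g.
Hypothesis gamma_gt0 : 0 < gamma.
Hypothesis rbz_gt0 : 0 < rbz.
Hypothesis rbdelta_gt0 : 0 < rbdelta.
Hypothesis kappa_ge0 : 0 <= kappa.
Hypothesis q_ge : 1 / 4 <= q.
Hypothesis q_lt : q < 1 / 2.
Hypothesis mu_gt0 : 0 < mu.
Hypothesis M_bound : forall v, enorm (M *m v) <= mu * enorm v.
Hypothesis Z_zbar : Zstar c g M Omega xi zbar.
Hypothesis sreg : strongly_regular c g M Omega gamma rbz rbdelta xi zbar.

Let T z delta := Linv c g M Omega delta zbar xi z.
Let F := Fmap c g.
Let xb := usubmx zbar.
Let yb := dsubmx zbar.

Let T_zbar : T zbar 0.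
Proof.
have := (Linv_exact_gap c M Omega zbar xi g_diff2 xi zbar).1 Z_zbar.
by rewrite exact_gap_zbar subrr mulmx0.
Qed.

Let C_bound xi' : enorm (Cmat n M *m (xi - xi')) <= mu * enorm (xi' - xi).
Proof. by rewrite Cmat_mul enorm_0col (le_trans (M_bound _)) // enormB. Qed.

Lemma jac_near_le x eta eta' : eta <= eta' -> jac_near g zbar x eta -> jac_near g zbar x eta'.
Proof.
move=> le [J1 J2]; split=> v.
  by rewrite (le_trans (J1 v)) // ler_wpM2r // enorm_ge0.
by rewrite (le_trans (J2 v)) // ler_wpM2r // enorm_ge0.
Qed.

(** The gap at [zbar] is the parameter shift plus the residual of the subproblem there. The residual
    costs less than q * r and the shift at most (1 - 2 * q) * r. *)
Lemma sub_gap_zbar_small r rxi eta xk H xi' :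
  gamma * (kappa + 2 * eta) <= q -> gamma * mu * rxi <= (1 - 2 * q) * r ->
  enorm (xk - xb) < r -> jac_near g zbar xk eta ->
  enorm (linearization_gap c g zbar xb xk) <= eta * enorm (xb - xk) ->
  opnorm (hessL g zbar - H) <= kappa -> eball xi rxi xi' ->
  gamma * enorm (sub_gap c g M zbar xi xk H xi' zbar) < (1 - q) * r.
Proof.
move=> Hq Hrxi xkr J1 fo WH bxi.
have -> : sub_gap c g M zbar xi xk H xi' zbar =
    Cmat n M *m (xi - xi') + (F zbar - sub_map c g xk H zbar).
  by rewrite -(exact_gap_zbar c g M zbar xi xi') -(sub_gap_exact_gap c g M zbar xi xk H xi' zbar) addrC subrK.
have h1 := C_bound xi'.
have h2 : enorm (F zbar - sub_map c g xk H zbar) <=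
    (kappa + eta) * enorm (xb - xk) + eta * enorm (xb - xk) + 0.
  apply: (residual_le WH J1 fo).
  have -> : dsubmx zbar - dsubmx zbar = 0 by exact: subrr.
  by rewrite mulmx0 enorm0.
have h3 := enormD (Cmat n M *m (xi - xi')) (F zbar - sub_map c g xk H zbar).
have h4 : gamma * mu * enorm (xi' - xi) <= (1 - 2 * q) * r.
  by apply: le_trans Hrxi; rewrite ler_pM2l ?mulr_gt0 // ltW.
have h5 : gamma * (kappa + 2 * eta) * enorm (xb - xk) <= q * enorm (xb - xk).
  by rewrite ler_wpM2r // enorm_ge0.
have h6 : q * enorm (xb - xk) < q * r.
  by rewrite ltr_pM2l ?(lt_le_trans _ q_ge) // enormB.
have h7 : gamma * enorm (Cmat n M *m (xi - xi') + (F zbar - sub_map c g xk H zbar)) <=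
   gamma * (mu * enorm (xi' - xi) + (kappa + 2 * eta) * enorm (xb - xk)).
  by rewrite ler_pM2l //; move: h1 h2 h3; lra.
by move: h4 h5 h6 h7; lra.
Qed.

(** The modulus eta is left abstract so that it can come from differentiability at [zbar] or be
    omega * r under the Lipschitz bound. *)
Lemma sub_solvable r rxi eta :
  0 < r -> r <= rbz -> r <= gamma * rbdelta -> 0 <= eta ->
  gamma * (kappa + 2 * eta) <= q ->
  gamma * mu * rxi <= (1 - 2 * q) * r ->
  (forall x, enorm (x - xb) < r ->
     jac_near g zbar x eta /\
     enorm (linearization_gap c g zbar xb x) <= eta * enorm (xb - x)) ->
  sub_uniquely_solvable c g M Omega r rxi xi zbar kappa.
Proof.
move=> r0 r1 r2 eta0 Hq Hrxi Hloc H zk xi' H_psd WH Ozk bzk bxi _.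
case: sreg => zs [zsE zs_lip].
set xk := usubmx zk.
have xkr : enorm (xk - xb) < r.
  by apply: le_lt_trans bzk; rewrite -usubmxB enorm_usub.
have [J1 fo] := Hloc _ xkr.
have L0 : 0 <= kappa + 2 * eta by rewrite addr_ge0 // mulr_ge0.
have q1 : q < 1 by move: q_lt; lra.
have [||z' [Hz' _]] := @contraction_solution _ _ T zbar gamma rbz rbdelta zs gamma_gt0 rbz_gt0
  rbdelta_gt0 zsE zs_lip T_zbar (sub_gap c g M zbar xi xk H xi') r (kappa + 2 * eta) q r1 r2 L0 Hq q1 r0.
- by move=> z1 z2 _ _; apply: sub_gap_lip.
- exact: sub_gap_zbar_small Hq Hrxi xkr J1 fo WH bxi.
- exists z'; rewrite -Hz'; apply/seteqP; split=> z [bz Kz]; split=> //.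
  + exact: (Linv_sub_gap c M Omega zbar xi g_diff2 xk H xi' z).1 Kz.
  + exact: (Linv_sub_gap c M Omega zbar xi g_diff2 xk H xi' z).2 Kz.
Qed.

Lemma kkt_nonempty_local : exists2 rxi, 0 < rxi & kkt_nonempty c g M Omega rxi xi.
Proof.
case: sreg => zs [zsE zs_lip].
pose N : R := (n + m)%:R.
have N1 : 0 < N + 1 by rewrite ltr_wpDl.
(* A box of half-width rho lies in the Euclidean ball of radius N * rho. This eta makes the
   remainder cost at most rho / 2 after multiplication by gamma; the other half is left to the
   parameter. *)
pose eta := (2 * gamma * (N + 1))^-1.
have eta0 : 0 < eta by rewrite invr_gt0 !mulr_gt0.
have [dl dl0 Hdl] := fder_Fmap c g_diff2 zbar eta0.
pose rho := Num.min (dl / (N + 1)) (gamma * rbdelta / 2).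
have rho0 : 0 < rho by rewrite lt_min !divr_gt0 // mulr_gt0.
have rho1 : rho < gamma * rbdelta.
  rewrite gt_min; apply/orP; right; rewrite ltr_pdivrMr // mulrDr mulr1 ltrDl.
  exact: mulr_gt0.
have rho2 : N * rho < dl.
  have h : rho * (N + 1) <= dl by rewrite -ler_pdivlMr // ge_min lexx.
  by move: h rho0; rewrite mulrDr mulr1 mulrC; lra.
have gm : 0 < 2 * gamma * mu by rewrite !mulr_gt0.
exists (rho / (2 * gamma * mu)); first by rewrite divr_gt0.
move=> xi'; rewrite /eball /= ltr_pdivlMr // => bxi.
have [| |z /(Linv_exact_gap c M Omega zbar xi g_diff2 xi' z).2 Kz] :=
  brouwer_solution (T := T) gamma_gt0 rbz_gt0 rbdelta_gt0 zsE zs_lip T_zbar (e := exact_gap c g M zbar xi xi') rho0 rho1.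
- move=> z bz.
  have hz : enorm (z - zbar) <= N * rho by apply: enorm_le_coord => i; rewrite !mxE.
  have h1 := Hdl _ (le_lt_trans hz rho2).
  have zE : zbar + (z - zbar) = z by rewrite addrC subrK.
  rewrite zE -enormN -(exact_gap_sub c g M zbar xi xi') in h1.
  have h2 := enormD (exact_gap c g M zbar xi xi' z - exact_gap c g M zbar xi xi' zbar) (exact_gap c g M zbar xi xi' zbar).
  rewrite subrK exact_gap_zbar in h2 h1.
  have h3 := C_bound xi'.
  have h4 : eta * enorm (z - zbar) <= eta * (N * rho) by rewrite ler_pM2l.
  have h5 : gamma * (eta * (N * rho)) <= rho / 2.
    have -> : gamma * (eta * (N * rho)) = rho / 2 * (N / (N + 1)).
      by rewrite /eta; field; rewrite !gt_eqF.
    rewrite ler_piMr ?divr_ge0 // ?ltW // ltr_pdivrMr // mul1r ltrDl //.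
  have h6 : gamma * enorm (exact_gap c g M zbar xi xi' z) <= gamma * (eta * (N * rho) + mu * enorm (xi' - xi)).
    by rewrite ler_pM2l //; move: h1 h2 h3 h4; lra.
  by move: h5 h6 bxi; lra.
- move=> z eps eps0; have e20 : 0 < eps / 2 by rewrite divr_gt0.
  have [d1 d10 H1] := Fmap_continuous c g_diff2 z e20.
  pose k := `|opnorm (jacF g zbar)| + 1.
  have k0 : 0 < k by rewrite ltr_wpDl.
  exists (Num.min d1 (eps / 2 / k)); first by rewrite lt_min d10 divr_gt0.
  move=> h; rewrite lt_min ltr_pdivlMr // => /andP[/H1 h1 h2].
  rewrite exact_gap_sub enormN.
  have zE : z + h - z = h by rewrite addrC addKr.
  rewrite zE; apply: (le_lt_trans (enormD _ _)); rewrite enormN.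
  have h3 : enorm (jacF g zbar *m h) <= `|opnorm (jacF g zbar)| * enorm h.
    by rewrite (le_trans (opnorm_bound _ _)) // ler_wpM2r ?enorm_ge0 // ler_norm.
  have h4 := enorm_ge0 h.
  by move: h1 h2 h3 h4; rewrite /k mulrDr mulr1; lra.
- by exists z.
Qed.

(** One end of the gap is [xb] itself, so the derivative of F at [zbar] controls it without any
    bound on F' nearby. *)
Lemma jac_near_local eta : 0 < eta -> exists2 dl, 0 < dl & forall x, enorm (x - xb) < dl ->
  jac_near g zbar x eta /\
  enorm (linearization_gap c g zbar xb x) <= eta * enorm (xb - x).
Proof.
move=> eta0.
have [d1 d10 H1] := jac_continuous (g_diff2.2 xb) eta0.
have [d2 d20 H2] := fder_Fmap c g_diff2 zbar eta0.
exists (Num.min d1 d2); first by rewrite lt_min d10.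
move=> x; rewrite lt_min => /andP[h1 h2]; split.
  by have := H1 _ h1; have -> : xb + (x - xb) = x by rewrite addrC subrK.
have zE : col_mx x yb - zbar = col_mx (x - xb) 0.
  by rewrite -[zbar in LHS]vsubmxK opp_col_mx add_col_mx subrr.
have h3 : enorm (col_mx x yb - zbar) < d2 by rewrite zE enorm_col0.
have := H2 _ h3.
have -> : zbar + (col_mx x yb - zbar) = col_mx x yb by rewrite addrC subrK.
rewrite {2}zE enorm_col0 (enormB x) -enormN; congr (enorm _ <= _).
rewrite /linearization_gap -[X in _ = X - _ - _]/(F (col_mx xb yb)) /xb /yb vsubmxK.
exact: opp_linearization.
Qed.

(** * Estimates under a Lipschitz bound on F' *)

Section Lipschitz.
Variables omega r : R.
Hypothesis omega_ge0 : 0 <= omega.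
Hypothesis F_lip : jacF_lipschitz c g omega r zbar.

Lemma jacF_lip z v : eball zbar r z ->
  enorm ((jacF g z - jacF g zbar) *m v) <= omega * enorm (z - zbar) * enorm v.
Proof.
move=> bz; rewrite -!(jac_Fmap c g_diff2) (le_trans (opnorm_bound _ _)) //.
by rewrite ler_wpM2r ?enorm_ge0 // F_lip.
Qed.

(** The difference of Jacobians is an off-diagonal block of the difference of KKT matrices at (x,
    yb) and [zbar]; vectors with one zero block isolate it. *)
Lemma jac_near_lip x : enorm (x - xb) < r -> jac_near g zbar x (omega * enorm (x - xb)).
Proof.
move=> xr; pose z := col_mx x yb.
have zE : z - zbar = col_mx (x - xb) 0.
  by rewrite -[zbar in LHS]vsubmxK opp_col_mx add_col_mx subrr.
have nz : enorm (z - zbar) = enorm (x - xb) by rewrite zE enorm_col0.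
have bz : eball zbar r z by rewrite /eball /= nz.
split=> v.
  have := jacF_lip (col_mx v 0) bz; rewrite nz enorm_col0; apply: le_trans.
  apply: le_trans (enorm_dsub _).
  by rewrite dsub_block_sub /z col_mxKu.
have := jacF_lip (col_mx 0 v) bz; rewrite nz enorm_0col; apply: le_trans.
apply: le_trans (enorm_usub _).
by rewrite usub_block_sub /z col_mxKu.
Qed.

(** The segment stays within rho of [zbar], hence in the open ball where F' is controlled, and the
    mean value inequality applies with constant omega * rho. *)
Lemma Fmap_linearization_lip z1 z2 rho : rho < r ->
  enorm (z1 - zbar) <= rho -> enorm (z2 - zbar) <= rho ->
  enorm (F z1 - F z2 - jacF g zbar *m (z1 - z2)) <= omega * rho * enorm (z1 - z2).
Proof.
move=> rr h1 h2; apply: (@fder_mvt R _ _ F (jacF g)); first exact: fder_Fmap.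
move=> t /andP[t0 t1] v.
have h : enorm (z2 + t *: (z1 - z2) - zbar) <= rho.
  have -> : z2 + t *: (z1 - z2) - zbar = t *: (z1 - zbar) + (1 - t) *: (z2 - zbar).
    by apply/matrixP => i j; rewrite !mxE; ring.
  apply: (le_trans (enormD _ _)); rewrite !enormZ (gtr0_norm t0) gtr0_norm ?subr_gt0 //.
  have e1 : t * enorm (z1 - zbar) <= t * rho by rewrite ler_pM2l.
  have e2 : (1 - t) * enorm (z2 - zbar) <= (1 - t) * rho by rewrite ler_pM2l // subr_gt0.
  by move: e1 e2; lra.
apply: (le_trans (jacF_lip v _)); first exact: le_lt_trans rr.
by rewrite ler_wpM2r ?enorm_ge0 // ler_wpM2l.
Qed.

Lemma linearization_gap_lip x1 x2 rho : rho < r ->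
  enorm (x1 - xb) <= rho -> enorm (x2 - xb) <= rho ->
  enorm (linearization_gap c g zbar x1 x2) <= omega * rho * enorm (x1 - x2).
Proof.
have zE x : col_mx x yb - zbar = col_mx (x - xb) 0.
  by rewrite -[zbar in LHS]vsubmxK opp_col_mx add_col_mx subrr.
move=> rr h1 h2.
have E : enorm (x1 - x2) = enorm (col_mx x1 yb - col_mx x2 yb).
  by rewrite opp_col_mx add_col_mx subrr enorm_col0.
by rewrite E; apply: Fmap_linearization_lip rr _ _; rewrite zE enorm_col0.
Qed.

Hypothesis r_gt0 : 0 < r.
Hypothesis r_rbz : r <= rbz.
Hypothesis r_rbdelta : r <= gamma * rbdelta.
Hypothesis r_q : gamma * (kappa + 3 * (omega * r)) <= q.

Let gamma_omega_r : gamma * (omega * r) <= 1 / 2.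
Proof.
have h1 : 0 <= gamma * kappa by rewrite mulr_ge0 // ltW.
have h2 : 0 <= gamma * (omega * r) by rewrite !mulr_ge0 // ltW.
by move: r_q q_lt; rewrite mulrDr; lra.
Qed.

Let omega_r_ge0 : 0 <= omega * r. Proof. by rewrite mulr_ge0 // ltW. Qed.

Variable rxi : R.
Hypothesis rxi_r : gamma * mu * rxi <= (1 - 2 * q) * r.

(** The contraction constant is taken as 1/2, and the factor 2 in the distance bound is 1 / (1 -
    1/2). *)
Lemma exact_solution xi' : eball xi rxi xi' -> exists zbar',
  Zstar c g M Omega xi' `&` eball zbar r = [set zbar'] /\
  enorm (zbar' - zbar) <= 2 * gamma * mu * enorm (xi' - xi).
Proof.
move=> bxi; case: sreg => zs [zsE zs_lip].
have h0 : gamma * enorm (exact_gap c g M zbar xi xi' zbar) <= gamma * mu * enorm (xi' - xi).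
  by rewrite exact_gap_zbar -mulrA ler_pM2l // C_bound.
have half1 : 1 / 2 < 1 :> R by lra.
have [||z' [Hz' hd]] := @contraction_solution _ _ T zbar gamma rbz rbdelta zs gamma_gt0 rbz_gt0
  rbdelta_gt0 zsE zs_lip T_zbar (exact_gap c g M zbar xi xi') r (omega * r) (1 / 2) r_rbz r_rbdelta omega_r_ge0 gamma_omega_r half1 r_gt0.
- move=> z1 z2 b1 b2; rewrite exact_gap_sub enormN.
  pose rho := Num.max (enorm (z1 - zbar)) (enorm (z2 - zbar)).
  have rr : rho < r by rewrite gt_max; apply/andP.
  apply: (@le_trans _ _ (omega * rho * enorm (z1 - z2))).
    by apply: Fmap_linearization_lip; rewrite // le_max lexx ?orbT.
  by rewrite ler_wpM2r ?enorm_ge0 // ler_wpM2l // ltW.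
- apply: (le_lt_trans h0).
  have h1 : gamma * mu * enorm (xi' - xi) < gamma * mu * rxi by rewrite ltr_pM2l // mulr_gt0.
  have h2 : (1 - 2 * q) * r <= (1 - 1 / 2) * r by rewrite ler_pM2r //; move: q_ge; lra.
  by move: rxi_r h1 h2; lra.
- exists z'; split; last by move: hd h0; lra.
  rewrite -Hz'; apply/seteqP; split=> z [K1 K2]; split=> //.
  + exact: (Linv_exact_gap c M Omega zbar xi g_diff2 xi' z).1 K1.
  + exact: (Linv_exact_gap c M Omega zbar xi g_diff2 xi' z).2 K2.
Qed.

Lemma kkt_nonempty_lip : kkt_nonempty c g M Omega rxi xi.
Proof.
move=> xi' /exact_solution[z' [/seteqP[_ /(_ z' erefl)[Kz _]] _]].
by exists z'.
Qed.

Lemma sub_solvable_lip : sub_uniquely_solvable c g M Omega r rxi xi zbar kappa.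
Proof.
apply: (@sub_solvable r rxi (omega * r)) => //.
  apply: le_trans r_q; rewrite ler_pM2l // lerD2l; move: omega_r_ge0; lra.
move=> x xr; split.
  by apply: jac_near_le (jac_near_lip xr); rewrite ler_wpM2l // ltW.
have := @linearization_gap_lip xb x (enorm (x - xb)) xr; rewrite subrr enorm0 enorm_ge0 => /(_ isT (lexx _)) h.
by apply: (le_trans h); rewrite ler_wpM2r ?enorm_ge0 // ler_wpM2l // ltW.
Qed.

Hypothesis Omega_convex : convex_set Omega.

Lemma error_bound xi' zbar' H zk z' : eball xi rxi xi' ->
  Zstar c g M Omega xi' `&` eball zbar r = [set zbar'] ->
  psd H -> opnorm (hessL g zbar - H) <= kappa ->
  Omega (usubmx zk) -> eball zbar r zk -> slater g M Omega (usubmx zk) xi' ->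
  sub_kkt c g M Omega (usubmx zk) H xi' z' ->
  (1 - q) * enorm (z' - zbar') <= gamma *
     (kappa * (enorm (zk - zbar) + enorm (zbar' - zbar)) +
      3 * omega * (enorm (zk - zbar) + enorm (zbar' - zbar)) ^+ 2).
Proof.
move=> bxi Zz' Hp WH Ozk bzk sl Kz'.
have /seteqP[_ /(_ zbar' erefl)[Kzb bzb]] := Zz'.
have [w Hw] := sub_solvable_lip Hp WH Ozk bzk bxi sl.
have wE := sub_kkt_global Omega_convex Hp Hw Kz'.
have /seteqP[_ /(_ w erefl)[bw _]] := Hw; rewrite -wE in bw.
set s := enorm (zk - zbar); set d := enorm (zbar' - zbar).
have s0 : 0 <= s := enorm_ge0 _; have d0 : 0 <= d := enorm_ge0 _.
set xk := usubmx zk in Ozk sl Kz' Hw *.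
have xks : enorm (xk - xb) <= s by rewrite -usubmxB enorm_usub.
have xkr : enorm (xk - xb) < r by apply: le_lt_trans bzk.
have xdd : enorm (usubmx zbar' - xb) <= d by rewrite -usubmxB enorm_usub.
have xdr : enorm (usubmx zbar' - xb) < r by apply: le_lt_trans bzb.
have Jk : jac_near g zbar xk (omega * s).
  by apply: jac_near_le (jac_near_lip xkr); rewrite ler_wpM2l.
have Jd : jac_near g zbar (usubmx zbar') (omega * d).
  by apply: jac_near_le (jac_near_lip xdr); rewrite ler_wpM2l.
have Jk' : jac_near g zbar xk (omega * r).
  by apply: jac_near_le Jk; rewrite ler_wpM2l // ltW.
have dx : enorm (usubmx zbar' - xk) <= s + d.
  by rewrite (le_trans (enormBD xb _ _)) // addrC lerD // enormB.
have fo : enorm (linearization_gap c g zbar (usubmx zbar') xk) <= omega * (s + d) * (s + d).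
  pose rho := Num.max s d.
  have rr : rho < r by rewrite gt_max; apply/andP.
  have rsd : rho <= s + d by rewrite ge_max lerDl lerDr s0 d0.
  apply: (@le_trans _ _ (omega * rho * enorm (usubmx zbar' - xk))).
    apply: (linearization_gap_lip rr); first by rewrite le_max xdd orbT.
    by rewrite le_max xks.
  rewrite -!mulrA ler_wpM2l // ler_pM ?enorm_ge0 // le_max s0 //.
have t2 : enorm ((jac g (usubmx zbar') - jac g xk)^T *m (dsubmx zbar' - yb)) <=
    (omega * d + omega * s) * d.
  apply: (le_trans (jac_near_sub _ Jd Jk)); rewrite ler_wpM2l //.
    by rewrite addr_ge0 // mulr_ge0.
  by rewrite -dsubmxB enorm_dsub.
have := residual_le WH Jk fo t2.
set res := enorm _ => Hres.
case: sreg => zs [zsE zs_lip].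
have L0 : 0 <= kappa + 2 * (omega * r) by rewrite addr_ge0 // mulr_ge0.
have q1 : q < 1 by move: q_lt; lra.
have gL : gamma * (kappa + 2 * (omega * r)) <= q.
  by apply: le_trans r_q; rewrite ler_pM2l // lerD2l; move: omega_r_ge0; lra.
(* The exact gap must be an admissible perturbation: parameter shift and remainder each use at most
   r / 2, the first one strictly. *)
have small : eball 0 rbdelta (exact_gap c g M zbar xi xi' zbar').
  rewrite /eball /= subr0 -(ltr_pM2l gamma_gt0).
  apply: lt_le_trans r_rbdelta.
  have h1 : gamma * enorm (Cmat n M *m (xi - xi')) <= gamma * (mu * enorm (xi' - xi)).
    by rewrite ler_pM2l // C_bound.
  have h2 : gamma * mu * enorm (xi' - xi) < gamma * mu * rxi by rewrite ltr_pM2l // mulr_gt0.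
  have h3 : (1 - 2 * q) * r <= 1 / 2 * r by rewrite ler_pM2r //; move: q_ge; lra.
  have h4 : enorm (exact_gap c g M zbar xi xi' zbar' - exact_gap c g M zbar xi xi' zbar) <= omega * d * d.
    rewrite exact_gap_sub enormN; apply: (@Fmap_linearization_lip _ _ d) => //.
    by rewrite subrr enorm0.
  have h5 : gamma * (omega * d * d) <= 1 / 2 * r.
    have dr : d <= r := ltW bzb.
    have a1 : omega * d * d <= omega * r * r by rewrite -!mulrA ler_wpM2l // ler_pM.
    apply: (@le_trans _ _ (gamma * (omega * r * r))); first by rewrite ler_pM2l.
    by rewrite mulrA ler_pM2r.
  have h6 := enormD (exact_gap c g M zbar xi xi' zbar' - exact_gap c g M zbar xi xi' zbar) (exact_gap c g M zbar xi xi' zbar).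
  rewrite subrK exact_gap_zbar in h6 h4.
  have h7 : gamma * enorm (exact_gap c g M zbar xi xi' zbar') <=
     gamma * (omega * d * d + enorm (Cmat n M *m (xi - xi'))).
    by rewrite ler_pM2l //; move: h4 h6; lra.
  by move: rxi_r h1 h2 h3 h5 h7; lra.
have Tz' := (Linv_sub_gap c M Omega zbar xi g_diff2 xk H xi' z').1 Kz'.
have Tzb := (Linv_exact_gap c M Omega zbar xi g_diff2 xi' zbar').1 Kzb.
have fo' : enorm (linearization_gap c g zbar xb xk) <= omega * r * enorm (xb - xk).
  have := @linearization_gap_lip xb xk s bzk; rewrite subrr enorm0 => /(_ s0 xks) h.
  by apply: (le_trans h); rewrite ler_wpM2r ?enorm_ge0 // ler_wpM2l // ltW.
have eS0 := sub_gap_zbar_small gL rxi_r xkr Jk' fo' WH bxi.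
have eSl : forall z1 z2, eball zbar r z1 -> eball zbar r z2 ->
    enorm (sub_gap c g M zbar xi xk H xi' z1 - sub_gap c g M zbar xi xk H xi' z2) <=
    (kappa + 2 * (omega * r)) * enorm (z1 - z2).
  by move=> z1 z2 _ _; apply: sub_gap_lip.
have := solution_lip (T := T) gamma_gt0 zsE zs_lip r_rbz r_rbdelta L0 gL r_gt0 eSl eS0 bw bzb Tz' small Tzb.
rewrite sub_gap_exact_gap -/res => /le_trans; apply; rewrite ler_pM2l //.
apply: (le_trans Hres).
(* Three second-order terms remain, each at most omega * (s + d) ^+ 2; this is the factor 3. *)
have h1 : (kappa + omega * s) * enorm (usubmx zbar' - xk) <= (kappa + omega * s) * (s + d).
  by rewrite ler_wpM2l // addr_ge0 // mulr_ge0.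
have h2 : 0 <= omega * (d * s) by rewrite !mulr_ge0.
have h3 : 0 <= omega * (s * s) by rewrite !mulr_ge0.
have h4 : 0 <= omega * (d * d) by rewrite !mulr_ge0.
by move: h1 h2 h3 h4; rewrite expr2; lra.
Qed.

End Lipschitz.
End Local.

(** * Choice of the constants and the induction *)

(** Replacing d by its bound D and (s + d)^2 by 2 s^2 + 2 D^2 removes the mixed terms in s and t.
    The terms X and 1 added to the coefficients are pure slack, X s^2 + t + t^2. *)
Lemma error_bound_quadratic (R : realType) (E s d t gamma kappa q omega mu X : R) :
  0 < gamma -> 0 <= kappa -> q < 1 -> 0 <= omega -> 0 < mu -> 0 <= X ->
  0 <= s -> 0 <= d -> 0 <= t -> d <= 2 * gamma * mu * t ->
  (1 - q) * E <= gamma * (kappa * (s + d) + 3 * omega * (s + d) ^+ 2) ->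
  E <= (gamma * kappa / (1 - q) + (6 * gamma * omega / (1 - q) + X) * s) * s +
       ((2 * gamma ^+ 2 * kappa * mu / (1 - q) + 1) +
        (6 * gamma * omega * (2 * gamma * mu) ^+ 2 / (1 - q) + 1) * t) * t.
Proof.
move=> g0 k0 q1 o0 m0 X0 s0 d0 t0 dt HE.
have Q0 : 0 < 1 - q by rewrite subr_gt0.
set D := 2 * gamma * mu * t in dt.
have D0 : 0 <= D by rewrite !mulr_ge0 // ltW.
have h1 : kappa * d <= kappa * D by rewrite ler_wpM2l.
have h2 : (s + d) ^+ 2 <= 2 * s ^+ 2 + 2 * D ^+ 2.
  have a1 : d ^+ 2 <= D ^+ 2 by rewrite ler_pXn2r // nnegrE.
  by have := sqr_ge0 (s - d); move: a1; rewrite sqrrB sqrrD; lra.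
have h3 : 3 * omega * (s + d) ^+ 2 <= 3 * omega * (2 * s ^+ 2 + 2 * D ^+ 2).
  by rewrite ler_wpM2l // mulr_ge0.
have h4 : (1 - q) * E <= gamma * (kappa * s + kappa * D + 3 * omega * (2 * s ^+ 2 + 2 * D ^+ 2)).
  by apply: (le_trans HE); rewrite ler_pM2l //; move: h1 h3; lra.
have h5 : E <= gamma * (kappa * s + kappa * D + 3 * omega * (2 * s ^+ 2 + 2 * D ^+ 2)) / (1 - q).
  by rewrite ler_pdivlMr // mulrC.
apply: (le_trans h5); rewrite -subr_ge0.
have -> : (gamma * kappa / (1 - q) + (6 * gamma * omega / (1 - q) + X) * s) * s +
       ((2 * gamma ^+ 2 * kappa * mu / (1 - q) + 1) +
        (6 * gamma * omega * (2 * gamma * mu) ^+ 2 / (1 - q) + 1) * t) * t -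
   gamma * (kappa * s + kappa * D + 3 * omega * (2 * s ^+ 2 + 2 * D ^+ 2)) / (1 - q) =
   X * s ^+ 2 + t + t ^+ 2 by rewrite /D; field; rewrite gt_eqF.
by rewrite !addr_ge0 // mulr_ge0 // exprn_ge0.
Qed.

(** The bound on u is the nonnegative root of c3 t^2 + c2 t = S; completing the square gives the
    inequality below it. *)
Lemma quadratic_root_le (R : realType) (c2 c3 S t u : R) :
  0 < c2 -> 0 < c3 -> 0 <= S -> 0 <= t -> t <= u ->
  u <= (2 * c3)^-1 * (Num.sqrt (c2 ^+ 2 + 4 * c3 * S) - c2) ->
  (c2 + c3 * t) * t <= S.
Proof.
move=> c20 c30 S0 t0 tu Hu.
set D := c2 ^+ 2 + 4 * c3 * S in Hu.
have D0 : 0 <= D by rewrite addr_ge0 ?exprn_ge0 ?mulr_ge0 // ltW.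
have h1 : 2 * c3 * t + c2 <= Num.sqrt D.
  have : t <= (2 * c3)^-1 * (Num.sqrt D - c2) by apply: le_trans Hu.
  by rewrite ler_pdivlMl ?mulr_gt0 //; lra.
have h2 : (2 * c3 * t + c2) ^+ 2 <= D.
  rewrite -(sqr_sqrtr D0) ler_pXn2r // ?nnegrE ?sqrtr_ge0 // addr_ge0 ?mulr_ge0 // ltW //.
have : 4 * c3 * ((c2 + c3 * t) * t) <= 4 * c3 * S.
  by move: h2; rewrite /D !expr2; lra.
by rewrite ler_pM2l // mulr_gt0.
Qed.

Theorem theorem3p6 (R : realType) (n m p : nat)
    (c : 'cV[R]_n) (g : 'cV[R]_n -> 'cV[R]_m) (M : 'M[R]_(m, p))
    (Omega : set 'cV[R]_n) (P : set 'cV[R]_p) (xi0 : 'cV[R]_p)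
    (gamma rbz rbdelta kappa omega : R)
    (Omega_nonempty : Omega !=set0) (Omega_closed : closed Omega)
    (Omega_convex : convex_set Omega)
    (g_diff2 : twice_differentiable g)
    (P_xi0 : P xi0) (Zstar_xi0 : Zstar c g M Omega xi0 !=set0)
    (gamma_gt0 : 0 < gamma) (rbz_gt0 : 0 < rbz) (rbdelta_gt0 : 0 < rbdelta)
    (kappa_ge0 : 0 <= kappa) (kappa_lt : kappa < 1 / (2 * gamma))
    (omega_ge0 : 0 <= omega) :
  exists alpha c1 c2 c3 : R,
    [/\ [/\ 0 <= alpha, alpha < 1, 0 <= c1, 0 < c2 & 0 <= c3],
    (* (a), (b), (c) at an arbitrary iteration *)
      forall (xik : 'cV[R]_p) (zbark : 'cV[R]_(n + m)),
        P xik -> Zstar c g M Omega xik zbark ->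
        strongly_regular c g M Omega gamma rbz rbdelta xik zbark ->
        exists rz rxi : R,
          [/\ 0 < rz /\ 0 < rxi,
              kkt_nonempty c g M Omega rxi xik,
              sub_uniquely_solvable c g M Omega rz rxi xik zbark kappa &
              error_estimate c g M Omega rz rxi xik zbark
                kappa omega alpha c1 c2 c3] &
    (* (d), with radii that do not depend on the iteration *)
      exists rz rxi : R,
        [/\ 0 < rz /\ 0 < rxi,
            forall (xik : 'cV[R]_p) (zbark : 'cV[R]_(n + m)),
              P xik -> Zstar c g M Omega xik zbark ->
              strongly_regular c g M Omega gamma rbz rbdelta xik zbark ->
              jacF_lipschitz c g omega rz zbark ->
              [/\ kkt_nonempty c g M Omega rxi xik,
                  sub_uniquely_solvable c g M Omega rz rxi xik zbark kappa &
                  error_estimate c g M Omega rz rxi xik zbark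
                    kappa omega alpha c1 c2 c3] &
            forall (xi : nat -> 'cV[R]_p) (H : nat -> 'M[R]_n)
                (z zbar : nat -> 'cV[R]_(n + m)) (rtz rtxi : R),
              xi 0%N = xi0 ->
              pcscp_run c g M Omega P xi H z ->
              Zstar c g M Omega (xi 0%N) (zbar 0%N) ->
              (forall k, Zstar c g M Omega (xi k.+1) (zbar k.+1) /\
                         eball (zbar k) rz (zbar k.+1)) ->
              (forall k, strongly_regular c g M Omega gamma rbz rbdelta
                           (xi k) (zbar k)) ->
              (forall k, opnorm (hessL g (zbar k) - H k) <= kappa) ->
              (forall k, jacF_lipschitz c g omega rz (zbar k)) ->
              (forall k, eball (xi k) rxi (xi k.+1)) ->
              0 < rtz -> (rtz%:E < rz_bar alpha c1)%E -> rtz <= rz ->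
              0 < rtxi -> rtxi <= rxi_bar alpha c1 c2 c3 rtz ->
              enorm (z 0%N - zbar 0%N) <= rtz ->
              (forall k, enorm (xi k.+1 - xi k) <= rtxi) ->
              (forall k, enorm (z k.+1 - zbar k.+1) <= rtz) /\
              (exists B : R, forall k, enorm (z k - zbar k) <= B)]].
Proof.
(* The midpoint of gamma * kappa and 1/2: the lower gap absorbs the variation of the Jacobian, the
   upper one leaves (1 - 2 * q) * r for the parameter, and q >= 1/4 keeps this share at most r /
   2. *)
set q := (gamma * kappa + 1 / 2) / 2.
have gk0 : 0 <= gamma * kappa by rewrite mulr_ge0 // ltW.
have gk : gamma * kappa < 1 / 2.
  have := kappa_lt; rewrite ltr_pdivlMr ?mulr_gt0 //; lra.
have q_ge : 1 / 4 <= q by rewrite /q; lra.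
have q_lt : q < 1 / 2 by rewrite /q; lra.
have q1 : 0 < 1 - q by lra.
have q1' : q < 1 by lra.
have gkq : gamma * kappa < q by rewrite /q; lra.
(* The Jacobian variation that exactly exhausts the gap between gamma * kappa and q. *)
pose eta0 := (q - gamma * kappa) / (3 * gamma).
have eta00 : 0 < eta0 by rewrite divr_gt0 ?mulr_gt0 // subr_gt0.
have eta0E : gamma * (kappa + 3 * eta0) = q.
  by rewrite /eta0; field; rewrite gt_eqF.
have o1 : 0 < omega + 1 by rewrite ltr_wpDl.
(* The added 1 makes mu positive, since [rad] divides by gamma * mu. *)
pose mu : R := m%:R * (p%:R * `|M|) + 1.
have mu0 : 0 < mu by rewrite ltr_wpDl // !mulr_ge0.
have M_bound v : enorm (M *m v) <= mu * enorm v.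
  by rewrite (le_trans (mulmx_bound _ _)) // ler_wpM2r ?enorm_ge0 // lerDl.
(* A radius free of the iterate, with omega * R0 <= eta0; omega + 1 avoids a division by zero. *)
pose R0 := Num.min rbz (Num.min (gamma * rbdelta) (eta0 / (omega + 1))).
have R00 : 0 < R0 by rewrite !lt_min rbz_gt0 mulr_gt0 //= divr_gt0.
have R0P r : r <= R0 -> 0 < r ->
    [/\ r <= rbz, r <= gamma * rbdelta & gamma * (kappa + 3 * (omega * r)) <= q].
  rewrite !le_min => /and3P[h1 h2 h3] r0; split => //.
  rewrite -eta0E ler_pM2l // lerD2l ler_pM2l //.
  have h4 : r * (omega + 1) <= eta0 by rewrite -ler_pdivlMr.
  by move: h4; rewrite mulrDr mulr1 mulrC; lra.
pose alpha := gamma * kappa / (1 - q).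
have alpha0 : 0 <= alpha by rewrite divr_ge0 // ltW.
have alpha1 : alpha < 1 by rewrite ltr_pdivrMr // mul1r; lra.
(* The summand X of c1 forces rz_bar alpha c1 <= R0, so that rtz < R0 and the
   iterates of (d) stay in the open ball even though only rtz <= rz is assumed. *)
pose X := (1 - alpha) / R0.
have X0 : 0 < X by rewrite divr_gt0 // subr_gt0.
pose c1 := 6 * gamma * omega / (1 - q) + X.
(* The added 1 gives c2 > 0 even for kappa = 0; the one in [c3] gives c3 > 0, so that [rxi_bar] is
   always its square root branch. *)
pose c2 := 2 * gamma ^+ 2 * kappa * mu / (1 - q) + 1.
pose c3 := 6 * gamma * omega * (2 * gamma * mu) ^+ 2 / (1 - q) + 1.
have g0 : 0 <= gamma := ltW gamma_gt0.
have m0 : 0 <= mu := ltW mu0.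
have q0 : 0 <= 1 - q := ltW q1.
have c1X : X <= c1 by rewrite lerDr divr_ge0 // !mulr_ge0.
have c20 : 0 < c2 by rewrite ltr_wpDl // divr_ge0 // !mulr_ge0 // exprn_ge0.
have c30 : 0 < c3 by rewrite ltr_wpDl // divr_ge0 // !mulr_ge0 // exprn_ge0 // !mulr_ge0.
(* The largest parameter radius within the budget of [sub_gap_zbar_small]. *)
pose rad r := (1 - 2 * q) * r / (gamma * mu).
have gm : 0 < gamma * mu by rewrite mulr_gt0.
have rad0 r : 0 < r -> 0 < rad r by move=> r0; rewrite divr_gt0 // mulr_gt0 //; lra.
have radP r rxi : rxi <= rad r -> gamma * mu * rxi <= (1 - 2 * q) * r.
  by rewrite /rad ler_pdivlMr // mulrC.
have est r rxi xik zbark : 0 < r -> r <= R0 -> rxi <= rad r ->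
    Zstar c g M Omega xik zbark ->
    strongly_regular c g M Omega gamma rbz rbdelta xik zbark ->
    error_estimate c g M Omega r rxi xik zbark kappa omega alpha c1 c2 c3.
  move=> r0 rR rr Zb sr Fl xi' bxi; have [r1 r2 r3] := R0P r rR r0.
  have [zb' [Hz hd]] := exact_solution g_diff2 gamma_gt0 rbz_gt0 rbdelta_gt0 kappa_ge0
    q_ge q_lt mu0 M_bound Zb sr omega_ge0 Fl r0 r1 r2 r3 (radP _ _ rr) bxi.
  exists zb' => // H zk z' Hp WH Ozk bzk sl [_ Kz].
  apply: (error_bound_quadratic (d := enorm (zb' - zbark)) gamma_gt0 kappa_ge0 q1' omega_ge0 mu0 (ltW X0)) => //;
    rewrite ?enorm_ge0 //.
  exact: (error_bound g_diff2 gamma_gt0 rbz_gt0 rbdelta_gt0 kappa_ge0 q_ge q_lt mu0 M_bound Zb sr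
    omega_ge0 Fl r0 r1 r2 r3 (radP _ _ rr) Omega_convex bxi Hz Hp WH Ozk bzk sl Kz).
exists alpha, c1, c2, c3; split.
- by split=> //; [rewrite (le_trans (ltW X0))|exact: ltW].
- move=> xik zbark _ Zb sr.
  (* The bound on F' is a premise of the estimate only. For the first two claims the radius must
     also respect [dl], from differentiability at [zbark], and the parameter radius [rxi2], from
     Brouwer's theorem. *)
  have [dl dl0 Hdl] := jac_near_local c zbark g_diff2 eta00.
  have [rxi2 rxi20 Hkkt] := kkt_nonempty_local g_diff2 gamma_gt0 rbz_gt0 rbdelta_gt0 mu0 M_bound Zb sr.
  pose r := Num.min R0 dl.
  have r0 : 0 < r by rewrite lt_min R00.
  have rR : r <= R0 by rewrite ge_min lexx.
  have [r1 r2 _] := R0P r rR r0.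
  pose rxi := Num.min (rad r) rxi2.
  have rxi0 : 0 < rxi by rewrite lt_min rad0.
  have rr : rxi <= rad r by rewrite ge_min lexx.
  exists r, rxi; split=> //.
  + move=> xi' Hxi; apply: Hkkt; apply: lt_le_trans Hxi _.
    by rewrite ge_min lexx orbT.
  + apply: (sub_solvable g_diff2 gamma_gt0 rbz_gt0 rbdelta_gt0 kappa_ge0 q_ge q_lt mu0 M_bound Zb sr (eta := eta0)) => //.
    * exact: ltW.
    * by rewrite -eta0E ler_pM2l // lerD2l; lra.
    * exact: radP.
    * move=> x xr; apply: Hdl; apply: lt_le_trans xr _.
      by rewrite ge_min lexx orbT.
  + exact: est.
exists R0, (rad R0); split; first by split => //; exact: rad0.
- move=> xik zbark _ Zb sr Fl; have [r1 r2 r3] := R0P R0 (lexx _) R00.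
  split.
  + exact: (kkt_nonempty_lip g_diff2 gamma_gt0 rbz_gt0 rbdelta_gt0 kappa_ge0
      q_ge q_lt mu0 M_bound Zb sr omega_ge0 Fl R00 r1 r2 r3 (radP _ _ (lexx _))).
  + exact: (sub_solvable_lip g_diff2 gamma_gt0 rbz_gt0 rbdelta_gt0 kappa_ge0
      q_ge q_lt mu0 M_bound Zb sr omega_ge0 Fl R00 r1 r2 r3 (radP _ _ (lexx _))).
  + exact: est.
move=> xi H z zbar rtz rtxi _ [_ O0 psdH sl run] Z0 Zk srk WHk Flk bxi rtz0 rtz_lt _ rtxi0 rtxi_le z0 xi_le.
have c1_gt0 : 0 < c1 by apply: lt_le_trans c1X.
have {}rtz_lt : c1 * rtz < 1 - alpha.
  move: rtz_lt; rewrite /rz_bar gt_eqF // lte_fin => h.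
  by rewrite -ltr_pdivlMl.
have rtzR : rtz < R0.
  have : X * rtz < 1 - alpha by apply: le_lt_trans rtz_lt; rewrite ler_pM2r.
  rewrite /X mulrAC ltr_pdivrMr // ltr_pM2l ?subr_gt0 //.
have Zall k : Zstar c g M Omega (xi k) (zbar k) by case: k => [//|k]; case: (Zk k).
have Oall k : Omega (usubmx (z k)) by case: k => [//|k]; case: (run k) => [[[]]].
have S0 : 0 <= rtz * (1 - alpha - c1 * rtz) by rewrite mulr_ge0 ?(ltW rtz0) // subr_ge0 ltW.
have step k : enorm (z k - zbar k) <= rtz -> enorm (z k.+1 - zbar k.+1) <= rtz.
  move=> IH; have bz : eball (zbar k) R0 (z k) by apply: le_lt_trans rtzR.
  have [w Hw Hest] := est R0 (rad R0) (xi k) (zbar k) R00 (lexx _) (lexx _) (Zall k) (srk k) (Flk k) _ (bxi k).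
  (* Uniqueness in the ball identifies the given KKT point with the one of the estimate. *)
  have wE : zbar k.+1 = w.
    have [Zk1 bk1] := Zk k.
    by have /seteqP[/(_ (zbar k.+1) (conj Zk1 bk1)) ->] := Hw.
  have := Hest (H k) (z k) (z k.+1) (psdH k) (WHk k) (Oall k) bz (sl k) (run k).
  rewrite -wE => h; apply: (le_trans h).
  have h1 : (c2 + c3 * enorm (xi k.+1 - xi k)) * enorm (xi k.+1 - xi k) <= rtz * (1 - alpha - c1 * rtz).
    apply: (@quadratic_root_le _ _ _ _ _ rtxi) => //; first exact: enorm_ge0.
    by move: rtxi_le; rewrite /rxi_bar gt_eqF // -!mulrA.
  have h2 : (alpha + c1 * enorm (z k - zbar k)) * enorm (z k - zbar k) <= (alpha + c1 * rtz) * rtz.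
    rewrite ler_pM ?enorm_ge0 // ?lerD2l ?ler_pM2l // addr_ge0 // mulr_ge0 ?enorm_ge0 // ltW //.
  (* The two bounds add up to exactly [rtz]. *)
  by move: h1 h2; lra.
have all k : enorm (z k - zbar k) <= rtz by elim: k => [//|k]; exact: step.
by split=> [k|]; [exact: all|exists rtz].
Qed.
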